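(* Let $J\colon\mathcal A\to\mathcal E$ be a pseudofunctor between bicategories and let $T$ be a $J$-relative pseudomonad. By restricting the 1-cells of the bicategory $\mathrm{PsAlg}_l(T)$ of $T$-pseudoalgebras, lax morphisms and transformations, one obtains: (1) a bicategory $\mathrm{PsAlg}(T)$ of $T$-pseudoalgebras, pseudomorphisms and transformations, equipped with a locally fully faithful strict pseudofunctor $\mathrm{PsAlg}(T)\to\mathrm{PsAlg}_l(T)$; (2) assuming $\mathcal E$ is a 2-category, a 2-category $\mathrm{PsAlg}_s(T)$ of $T$-pseudoalgebras, strict morphisms and transformations, equipped with a locally fully faithful strict 2-functor $\mathrm{PsAlg}_s(T)\to\mathrm{PsAlg}(T)$. Furthermore, by considering colax morphisms instead of lax morphisms, one obtains: (3) a bicategory $\mathrm{PsAlg}_c(T)$ of $T$-pseudoalgebras, colax morphisms and transformations, together with a locally fully faithful strict pseudofunctor $\mathrm{PsAlg}(T)\to\mathrm{PsAlg}_c(T)$. By restricting the objects of each of the bicategories $\mathrm{PsAlg}_l(T)$, $\mathrm{PsAlg}(T)$, $\mathrm{PsAlg}_c(T)$ and (assuming $\mathcal E$ is a 2-category) the 2-category $\mathrm{PsAlg}_s(T)$ to strict algebras, one obtains full sub-bicategories $\mathrm{Alg}_l(T)\hookrightarrow\mathrm{PsAlg}_l(T)$, $\mathrm{Alg}(T)\hookrightarrow\mathrm{PsAlg}(T)$, $\mathrm{Alg}_c(T)\hookrightarrow\mathrm{PsAlg}_c(T)$, and, assuming $\mathcal E$ is a 2-category, a 2-category $\mathrm{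Alg}_s(T)\hookrightarrow\mathrm{PsAlg}_s(T)$.
   Context: Conventions. For a bicategory $\mathcal E$, $\mathcal E[X,Y]$ is the hom-category; composition of 1-cells and whiskering are written by juxtaposition, vertical composition of 2-cells by $\circ$; structural isomorphisms (associators, unitors, pseudofunctor constraints) are left implicit in equations or written $\cong$. A pseudofunctor is strict if its compositors and unitors are identities, and locally fully faithful if its action on each hom-category is fully faithful. A $J$-relative pseudomonad $T$ comprises: an object $TX\in\mathcal E$ for each $X\in\mathcal A$; functors $(-)^*\colon\mathcal E[JX,TY]\to\mathcal E[TX,TY]$ for $X,Y\in\mathcal A$; 1-cells $i_X\colon JX\to TX$; invertible 2-cells $\mu_{g,f}\colon(g^*f)^*\Rightarrow g^*f^*$ natural in $f\colon JX\to TY$, $g\colon JY\to TZ$; invertible 2-cells $\eta_f\colon f\Rightarrow f^*i_X$ natural in $f\colon JX\to TY$; invertible 2-cells $\theta_X\colon(i_X)^*\Rightarrow 1_{TX}$; such that $(\mu_{h,g}f^* )\circ\mu_{h^*g,f}=(h^*\mu_{g,f})\circ\mu_{h,g^*f}\circ(\mu_{h,g}f)^*$ for all $f\colon JW\to TX$, $g\colon JX\to TY$, $h\colon JY\to TZ$, and $(f^*\theta_X)\circ\mu_{f,i_X}\circ(\eta_f)^*$ is the structural isomorphism $f^*\cong f^*1_{TX}$ for all $f\colon JX\to TY$. A $T$-pseudoalgebra $(A,(-)^a,\hat a,\tilde a)$ comprises: an object $A\in\mathcal E$; functors $(-)^a\colon\mathcal E[JX,A]\to\mathcal E[TX,A]$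 for $X\in\mathcal A$; invertible 2-cells $\hat a_{g,f}\colon(g^af)^a\Rightarrow g^af^*$ natural in $f\colon JX\to TY$, $g\colon JY\to A$; invertible 2-cells $\tilde a_f\colon f\Rightarrow f^ai_X$ natural in $f\colon JX\to A$; such that $(\hat a_{h,g}f^* )\circ\hat a_{h^ag,f}=(h^a\mu_{g,f})\circ\hat a_{h,g^*f}\circ(\hat a_{h,g}f)^a$ for all $f\colon JX\to TY$, $g\colon JY\to TZ$, $h\colon JZ\to A$, and $(f^a\theta_X)\circ\hat a_{f,i_X}\circ(\tilde a_f)^a$ is the structural isomorphism $f^a\cong f^a1_{TX}$ for all $f\colon JX\to A$. It is a strict algebra if every $\tilde a_f$ and every $\hat a_{g,f}$ is an identity 2-cell. A lax morphism $(h,\overline h)\colon(A,(-)^a,\hat a,\tilde a)\to(B,(-)^b,\hat b,\tilde b)$ comprises a 1-cell $h\colon A\to B$ and 2-cells $\overline h_f\colon(hf)^b\Rightarrow hf^a$ natural in $f\colon JX\to A$ such that $(h\hat a_{g,f})\circ\overline h_{g^af}\circ(\overline h_gf)^b=(\overline h_gf^* )\circ\hat b_{hg,f}$ for all $f\colon JX\to TY$, $g\colon JY\to A$, and $(\overline h_fi_X)\circ\tilde b_{hf}=h\tilde a_f$ for all $f\colon JX\to A$. It is a pseudomorphism if every $\overline h_f$ is invertible and a strict morphism if every $\overline h_f$ is an identity. A colax morphism is defined with the $\overline h_f$ reversed: natural 2-cells $\overline h_f\colon hf^a\Rightarrow(hf)^b$ with $\hat b_{hg,f}\circ(\overline h_gf)^b\circ\overline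 h_{g^af}=(\overline h_gf^* )\circ(h\hat a_{g,f})$ and $(\overline h_fi_X)\circ(h\tilde a_f)=\tilde b_{hf}$; a pseudomorphism is viewed as a colax morphism by inverting the 2-cells. A transformation of lax morphisms $(h,\overline h)\Rightarrow(h',\overline{h'})$ is a 2-cell $\alpha\colon h\Rightarrow h'$ with $\overline{h'}_f\circ(\alpha f)^b=(\alpha f^a)\circ\overline h_f$ for all $f$; a transformation of colax morphisms is one with $(\alpha f)^b\circ\overline h_f=\overline{h'}_f\circ(\alpha f^a)$. The bicategory $\mathrm{PsAlg}_l(T)$ has $T$-pseudoalgebras as objects, lax morphisms as 1-cells and transformations as 2-cells. The identity on $A$ is $1_A$ with $(1_Af)^a\cong f^a\cong 1_Af^a$; the composite of $(h,\overline h)\colon A\to B$ and $(h',\overline{h'})\colon B\to C$ is $h'h$ with $((h'h)f)^c\cong(h'(hf))^c\xrightarrow{\overline{h'}_{hf}}h'(hf)^b\xrightarrow{h'\overline h_f}h'(hf^a)\cong(h'h)f^a$; compositions of transformations, associators and unitors are those of $\mathcal E$. The colax case is analogous with reversed 2-cells. *)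

(* Defs.v *)
From Stdlib Require Import ClassicalEpsilon.

Set Implicit Arguments.
Unset Strict Implicit.
Unset Printing Implicit Defensive.

Declare Scope bicat_scope.
Delimit Scope bicat_scope with bicat.
Local Open Scope bicat_scope.

Reserved Notation "f ==> g" (at level 70, no associativity).
Reserved Notation "g · f" (at level 40, left associativity).
Reserved Notation "β • α" (at level 50, left associativity).
Reserved Notation "g ◁ α" (at level 38, right associativity).
Reserved Notation "β ▷ f" (at level 39, left associativity).

(** Operations and laws are kept apart, so that a bicategory can be written down
    before its laws are proved. Composites [g · f] are in applicative order. *)

Record BicatData : Type := {
  ob :> Type;
  hom : ob -> ob -> Type;
  cell : forall {X Y : ob}, hom X Y -> hom X Y -> Type
    where "f ==> g" := (cell f g);
  id1 : forall X : ob, hom X X;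
  comp : forall {X Y Z : ob}, hom Y Z -> hom X Y -> hom X Z
    where "g · f" := (comp g f);
  id2 : forall {X Y : ob} (f : hom X Y), f ==> f;
  vcomp : forall {X Y : ob} {f g h : hom X Y}, g ==> h -> f ==> g -> f ==> h;
  lwhisk : forall {X Y Z : ob} (g : hom Y Z) {f f' : hom X Y},
    f ==> f' -> g · f ==> g · f';
  rwhisk : forall {X Y Z : ob} {g g' : hom Y Z},
    g ==> g' -> forall f : hom X Y, g · f ==> g' · f;
  assoc : forall {W X Y Z : ob} (h : hom Y Z) (g : hom X Y) (f : hom W X),
    (h · g) · f ==> h · (g · f);
  assoc_inv : forall {W X Y Z : ob} (h : hom Y Z) (g : hom X Y) (f : hom W X),
    h · (g · f) ==> (h · g) · f;
  lunit : forall {X Y : ob} (f : hom X Y), id1 Y · f ==> f;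
  lunit_inv : forall {X Y : ob} (f : hom X Y), f ==> id1 Y · f;
  runit : forall {X Y : ob} (f : hom X Y), f · id1 X ==> f;
  runit_inv : forall {X Y : ob} (f : hom X Y), f ==> f · id1 X
}.

Arguments id1 {_} X.

Notation "f ==> g" := (cell f g) : bicat_scope.
Notation "g · f" := (comp g f) : bicat_scope.
Notation "β • α" := (vcomp β α) : bicat_scope.
Notation "g ◁ α" := (lwhisk g α) : bicat_scope.
Notation "β ▷ f" := (rwhisk β f) : bicat_scope.

Record is_bicategory (B : BicatData) : Prop := {
  vcomp_assoc : forall (X Y : B) (f g h k : hom X Y)
    (γ : h ==> k) (β : g ==> h) (α : f ==> g), γ • (β • α) = (γ • β) • α;
  vcomp_id_l : forall (X Y : B) (f g : hom X Y) (α : f ==> g), id2 g • α = α;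
  vcomp_id_r : forall (X Y : B) (f g : hom X Y) (α : f ==> g), α • id2 f = α;
  lwhisk_id : forall (X Y Z : B) (g : hom Y Z) (f : hom X Y),
    g ◁ id2 f = id2 (g · f);
  lwhisk_vcomp : forall (X Y Z : B) (g : hom Y Z) (f f' f'' : hom X Y)
    (β : f' ==> f'') (α : f ==> f'), g ◁ (β • α) = (g ◁ β) • (g ◁ α);
  rwhisk_id : forall (X Y Z : B) (g : hom Y Z) (f : hom X Y),
    id2 g ▷ f = id2 (g · f);
  rwhisk_vcomp : forall (X Y Z : B) (g g' g'' : hom Y Z) (f : hom X Y)
    (β : g' ==> g'') (α : g ==> g'), (β • α) ▷ f = (β ▷ f) • (α ▷ f);
  interchange : forall (X Y Z : B) (g g' : hom Y Z) (f f' : hom X Y)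
    (β : g ==> g') (α : f ==> f'), (β ▷ f') • (g ◁ α) = (g' ◁ α) • (β ▷ f);
  assoc_nat_r : forall (W X Y Z : B) (h : hom Y Z) (g : hom X Y)
    (f f' : hom W X) (α : f ==> f'),
    assoc h g f' • ((h · g) ◁ α) = (h ◁ (g ◁ α)) • assoc h g f;
  assoc_nat_m : forall (W X Y Z : B) (h : hom Y Z) (g g' : hom X Y)
    (f : hom W X) (β : g ==> g'),
    assoc h g' f • ((h ◁ β) ▷ f) = (h ◁ (β ▷ f)) • assoc h g f;
  assoc_nat_l : forall (W X Y Z : B) (h h' : hom Y Z) (g : hom X Y)
    (f : hom W X) (γ : h ==> h'),
    assoc h' g f • ((γ ▷ g) ▷ f) = (γ ▷ (g · f)) • assoc h g f;
  lunit_nat : forall (X Y : B) (f f' : hom X Y) (α : f ==> f'),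
    lunit f' • (id1 Y ◁ α) = α • lunit f;
  runit_nat : forall (X Y : B) (f f' : hom X Y) (α : f ==> f'),
    runit f' • (α ▷ id1 X) = α • runit f;
  assocK : forall (W X Y Z : B) (h : hom Y Z) (g : hom X Y) (f : hom W X),
    assoc_inv h g f • assoc h g f = id2 ((h · g) · f);
  assocVK : forall (W X Y Z : B) (h : hom Y Z) (g : hom X Y) (f : hom W X),
    assoc h g f • assoc_inv h g f = id2 (h · (g · f));
  lunitK : forall (X Y : B) (f : hom X Y),
    lunit_inv f • lunit f = id2 (id1 Y · f);
  lunitVK : forall (X Y : B) (f : hom X Y), lunit f • lunit_inv f = id2 f;
  runitK : forall (X Y : B) (f : hom X Y),
    runit_inv f • runit f = id2 (f · id1 X);
  runitVK : forall (X Y : B) (f : hom X Y), runit f • runit_inv f = id2 f;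
  pentagon : forall (V W X Y Z : B)
    (k : hom Y Z) (h : hom X Y) (g : hom W X) (f : hom V W),
    (k ◁ assoc h g f) • assoc k (h · g) f • (assoc k h g ▷ f)
    = assoc k h (g · f) • assoc (k · h) g f;
  triangle : forall (X Y Z : B) (g : hom Y Z) (f : hom X Y),
    (g ◁ lunit f) • assoc g (id1 Y) f = runit g ▷ f
}.

Record Bicategory : Type := {
  bicat_data :> BicatData;
  bicat_laws : is_bicategory bicat_data
}.

Definition invertible (B : BicatData) (X Y : B) (f g : hom X Y)
    (α : f ==> g) : Prop :=
  exists β : g ==> f, β • α = id2 f /\ α • β = id2 g.

Definition inv2 (B : BicatData) (X Y : B) (f g : hom X Y) (α : f ==> g)
    (Hα : invertible α) : g ==> f :=
  proj1_sig (constructive_indefinite_description _ Hα).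

(** [is_identity α] for [α : f ==> g] says that [f = g] and that, along this
    equality, [α] is the identity 2-cell. *)
Inductive is_identity (B : BicatData) (X Y : B) (f : hom X Y) :
    forall g : hom X Y, f ==> g -> Prop :=
  is_identity_id2 : is_identity (id2 f).

Record is_2category (B : BicatData) : Prop := {
  is_2category_bicategory : is_bicategory B;
  is_2category_assoc : forall (W X Y Z : B)
    (h : hom Y Z) (g : hom X Y) (f : hom W X), is_identity (assoc h g f);
  is_2category_lunit : forall (X Y : B) (f : hom X Y), is_identity (lunit f);
  is_2category_runit : forall (X Y : B) (f : hom X Y), is_identity (runit f)
}.

Record PseudofunctorData (B C : BicatData) : Type := {
  pf_ob :> B -> C;
  pf_hom : forall {X Y : B}, hom X Y -> hom (pf_ob X) (pf_ob Y);
  pf_cell : forall {X Y : B} {f g : hom X Y},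
    f ==> g -> pf_hom f ==> pf_hom g;
  compositor : forall {X Y Z : B} (g : hom Y Z) (f : hom X Y),
    pf_hom g · pf_hom f ==> pf_hom (g · f);
  unitor : forall X : B, id1 (pf_ob X) ==> pf_hom (id1 X)
}.

Arguments pf_hom {B C} F {X Y} f : rename.
Arguments pf_cell {B C} F {X Y f g} α : rename.
Arguments compositor {B C} F {X Y Z} g f : rename.
Arguments unitor {B C} F X : rename.

Record is_pseudofunctor (B C : BicatData) (F : PseudofunctorData B C) : Prop := {
  pf_cell_id : forall (X Y : B) (f : hom X Y),
    pf_cell F (id2 f) = id2 (pf_hom F f);
  pf_cell_vcomp : forall (X Y : B) (f g h : hom X Y)
    (β : g ==> h) (α : f ==> g),
    pf_cell F (β • α) = pf_cell F β • pf_cell F α;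
  compositor_invertible : forall (X Y Z : B) (g : hom Y Z) (f : hom X Y),
    invertible (compositor F g f);
  unitor_invertible : forall X : B, invertible (unitor F X);
  compositor_nat_r : forall (X Y Z : B) (g : hom Y Z) (f f' : hom X Y)
    (α : f ==> f'),
    compositor F g f' • (pf_hom F g ◁ pf_cell F α)
    = pf_cell F (g ◁ α) • compositor F g f;
  compositor_nat_l : forall (X Y Z : B) (g g' : hom Y Z) (f : hom X Y)
    (β : g ==> g'),
    compositor F g' f • (pf_cell F β ▷ pf_hom F f)
    = pf_cell F (β ▷ f) • compositor F g f;
  compositor_assoc : forall (W X Y Z : B)
    (h : hom Y Z) (g : hom X Y) (f : hom W X),
    pf_cell F (assoc h g f) • compositor F (h · g) f
      • (compositor F h g ▷ pf_hom F f)
    = compositor F h (g · f) • (pf_hom F h ◁ compositor F g f)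
      • assoc (pf_hom F h) (pf_hom F g) (pf_hom F f);
  unitor_l : forall (X Y : B) (f : hom X Y),
    pf_cell F (lunit f) • compositor F (id1 Y) f • (unitor F Y ▷ pf_hom F f)
    = lunit (pf_hom F f);
  unitor_r : forall (X Y : B) (f : hom X Y),
    pf_cell F (runit f) • compositor F f (id1 X) • (pf_hom F f ◁ unitor F X)
    = runit (pf_hom F f)
}.

Record Pseudofunctor (B C : BicatData) : Type := {
  pf_data :> PseudofunctorData B C;
  pf_laws : is_pseudofunctor pf_data
}.

Record is_strict_pseudofunctor (B C : BicatData) (F : PseudofunctorData B C) :
    Prop := {
  strict_pf_pseudofunctor : is_pseudofunctor F;
  strict_pf_compositor : forall (X Y Z : B) (g : hom Y Z) (f : hom X Y),
    is_identity (compositor F g f);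
  strict_pf_unitor : forall X : B, is_identity (unitor F X)
}.

Definition is_strict_2functor (B C : BicatData) (F : PseudofunctorData B C) :
    Prop :=
  is_2category B /\ is_2category C /\ is_strict_pseudofunctor F.

Definition locally_fully_faithful (B C : BicatData)
    (F : PseudofunctorData B C) : Prop :=
  forall (X Y : B) (f g : hom X Y) (β : pf_hom F f ==> pf_hom F g),
    exists! α : f ==> g, pf_cell F α = β.

Record is_full_inclusion (B C : BicatData) (F : PseudofunctorData B C) :
    Prop := {
  full_incl_strict : is_strict_pseudofunctor F;
  full_incl_ob : forall X Y : B, F X = F Y -> X = Y;
  full_incl_hom : forall (X Y : B) (k : hom (F X) (F Y)),
    exists! f : hom X Y, pf_hom F f = k;
  full_incl_cell : locally_fully_faithful F
}.

Definition HomPred (B : BicatData) : Type := forall X Y : B, hom X Y -> Prop.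
Definition CellPred (B : BicatData) : Type :=
  forall (X Y : B) (f g : hom X Y), f ==> g -> Prop.

Record cells_closed (B : BicatData) (P : HomPred B) (Q : CellPred B) : Prop := {
  cc_id1 : forall X : B, P X X (id1 X);
  cc_comp : forall (X Y Z : B) (g : hom Y Z) (f : hom X Y),
    P Y Z g -> P X Y f -> P X Z (g · f);
  cc_id2 : forall (X Y : B) (f : hom X Y), P X Y f -> Q X Y f f (id2 f);
  cc_vcomp : forall (X Y : B) (f g h : hom X Y) (β : g ==> h) (α : f ==> g),
    P X Y f -> P X Y g -> P X Y h ->
    Q X Y g h β -> Q X Y f g α -> Q X Y f h (β • α);
  cc_lwhisk : forall (X Y Z : B) (g : hom Y Z) (f f' : hom X Y) (α : f ==> f'),
    P Y Z g -> P X Y f -> P X Y f' ->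
    Q X Y f f' α -> Q X Z (g · f) (g · f') (g ◁ α);
  cc_rwhisk : forall (X Y Z : B) (g g' : hom Y Z) (β : g ==> g') (f : hom X Y),
    P Y Z g -> P Y Z g' -> P X Y f ->
    Q Y Z g g' β -> Q X Z (g · f) (g' · f) (β ▷ f);
  cc_assoc : forall (W X Y Z : B) (h : hom Y Z) (g : hom X Y) (f : hom W X),
    P Y Z h -> P X Y g -> P W X f ->
    Q W Z ((h · g) · f) (h · (g · f)) (assoc h g f);
  cc_assoc_inv : forall (W X Y Z : B) (h : hom Y Z) (g : hom X Y) (f : hom W X),
    P Y Z h -> P X Y g -> P W X f ->
    Q W Z (h · (g · f)) ((h · g) · f) (assoc_inv h g f);
  cc_lunit : forall (X Y : B) (f : hom X Y),
    P X Y f -> Q X Y (id1 Y · f) f (lunit f);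
  cc_lunit_inv : forall (X Y : B) (f : hom X Y),
    P X Y f -> Q X Y f (id1 Y · f) (lunit_inv f);
  cc_runit : forall (X Y : B) (f : hom X Y),
    P X Y f -> Q X Y (f · id1 X) f (runit f);
  cc_runit_inv : forall (X Y : B) (f : hom X Y),
    P X Y f -> Q X Y f (f · id1 X) (runit_inv f)
}.

(** The bicategory structure that [B] induces on the 1-cells in [P] and the
    2-cells in [Q]. *)
Definition cells_sub (B : BicatData) (P : HomPred B) (Q : CellPred B)
    (c : cells_closed P Q) : BicatData := {|
  ob := B;
  hom X Y := {f : hom X Y | P X Y f};
  cell X Y f g := {α : proj1_sig f ==> proj1_sig g | Q X Y _ _ α};
  id1 X := exist _ (id1 X) (cc_id1 c X);
  comp X Y Z g f := exist _ (proj1_sig g · proj1_sig f)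
    (cc_comp c (proj2_sig g) (proj2_sig f));
  id2 X Y f := exist _ (id2 (proj1_sig f)) (cc_id2 c (proj2_sig f));
  vcomp X Y f g h β α := exist _ (proj1_sig β • proj1_sig α)
    (cc_vcomp c (proj2_sig f) (proj2_sig g) (proj2_sig h)
       (proj2_sig β) (proj2_sig α));
  lwhisk X Y Z g f f' α := exist _ (proj1_sig g ◁ proj1_sig α)
    (cc_lwhisk c (proj2_sig g) (proj2_sig f) (proj2_sig f') (proj2_sig α));
  rwhisk X Y Z g g' β f := exist _ (proj1_sig β ▷ proj1_sig f)
    (cc_rwhisk c (proj2_sig g) (proj2_sig g') (proj2_sig f) (proj2_sig β));
  assoc W X Y Z h g f := exist _ (assoc (proj1_sig h) (proj1_sig g) (proj1_sig f))
    (cc_assoc c (proj2_sig h) (proj2_sig g) (proj2_sig f));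
  assoc_inv W X Y Z h g f :=
    exist _ (assoc_inv (proj1_sig h) (proj1_sig g) (proj1_sig f))
      (cc_assoc_inv c (proj2_sig h) (proj2_sig g) (proj2_sig f));
  lunit X Y f := exist _ (lunit (proj1_sig f)) (cc_lunit c (proj2_sig f));
  lunit_inv X Y f :=
    exist _ (lunit_inv (proj1_sig f)) (cc_lunit_inv c (proj2_sig f));
  runit X Y f := exist _ (runit (proj1_sig f)) (cc_runit c (proj2_sig f));
  runit_inv X Y f :=
    exist _ (runit_inv (proj1_sig f)) (cc_runit_inv c (proj2_sig f))
|}.

Record homs_closed (B : BicatData) (P : HomPred B) : Prop := {
  hc_id1 : forall X : B, P X X (id1 X);
  hc_comp : forall (X Y Z : B) (g : hom Y Z) (f : hom X Y),
    P Y Z g -> P X Y f -> P X Z (g · f)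
}.

(** The locally full version: all 2-cells between the 1-cells in [P]. *)
Definition homs_sub (B : BicatData) (P : HomPred B) (c : homs_closed P) :
    BicatData := {|
  ob := B;
  hom X Y := {f : hom X Y | P X Y f};
  cell X Y f g := proj1_sig f ==> proj1_sig g;
  id1 X := exist _ (id1 X) (hc_id1 c X);
  comp X Y Z g f := exist _ (proj1_sig g · proj1_sig f)
    (hc_comp c (proj2_sig g) (proj2_sig f));
  id2 X Y f := id2 (proj1_sig f);
  vcomp X Y f g h β α := β • α;
  lwhisk X Y Z g f f' α := proj1_sig g ◁ α;
  rwhisk X Y Z g g' β f := β ▷ proj1_sig f;
  assoc W X Y Z h g f := assoc (proj1_sig h) (proj1_sig g) (proj1_sig f);
  assoc_inv W X Y Z h g f := assoc_inv (proj1_sig h) (proj1_sig g) (proj1_sig f);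
  lunit X Y f := lunit (proj1_sig f);
  lunit_inv X Y f := lunit_inv (proj1_sig f);
  runit X Y f := runit (proj1_sig f);
  runit_inv X Y f := runit_inv (proj1_sig f)
|}.

Definition homs_incl (B : BicatData) (P : HomPred B) (c : homs_closed P) :
    PseudofunctorData (homs_sub c) B := {|
  pf_ob := fun X : homs_sub c => (X : B);
  pf_hom := fun X Y f => proj1_sig f;
  pf_cell := fun X Y f g α => α;
  compositor := fun X Y Z g f => id2 (proj1_sig g · proj1_sig f);
  unitor := fun X => id2 (id1 (X : B))
|}.

Definition homs_sub_map (B : BicatData) (P P' : HomPred B)
    (c : homs_closed P) (c' : homs_closed P')
    (PP' : forall (X Y : B) (f : hom X Y), P X Y f -> P' X Y f) :
    PseudofunctorData (homs_sub c) (homs_sub c') := {|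
  pf_ob := fun X : homs_sub c => (X : homs_sub c');
  pf_hom := fun X Y f => exist _ (proj1_sig f) (PP' X Y _ (proj2_sig f));
  pf_cell := fun X Y f g α => α;
  compositor := fun X Y Z g f => id2 (proj1_sig g · proj1_sig f);
  unitor := fun X => id2 (id1 (X : B))
|}.

Definition full_sub (B : BicatData) (P : B -> Prop) : BicatData := {|
  ob := {X : B | P X};
  hom X Y := hom (proj1_sig X) (proj1_sig Y);
  cell X Y f g := f ==> g;
  id1 X := id1 (proj1_sig X);
  comp X Y Z g f := g · f;
  id2 X Y f := id2 f;
  vcomp X Y f g h β α := β • α;
  lwhisk X Y Z g f f' α := g ◁ α;
  rwhisk X Y Z g g' β f := β ▷ f;
  assoc W X Y Z h g f := assoc h g f;
  assoc_inv W X Y Z h g f := assoc_inv h g f;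
  lunit X Y f := lunit f;
  lunit_inv X Y f := lunit_inv f;
  runit X Y f := runit f;
  runit_inv X Y f := runit_inv f
|}.

Definition full_incl (B : BicatData) (P : B -> Prop) :
    PseudofunctorData (full_sub P) B := {|
  pf_ob := fun X : full_sub P => proj1_sig X;
  pf_hom := fun X Y f => f;
  pf_cell := fun X Y f g α => α;
  compositor := fun X Y Z (g : hom (proj1_sig Y) (proj1_sig Z)) f => id2 (g · f);
  unitor := fun X => id2 (id1 (proj1_sig X))
|}.

Record HomFunctor (E : BicatData) (X Y X' Y' : E) : Type := {
  hf_ob :> hom X Y -> hom X' Y';
  hmap : forall {f g : hom X Y}, f ==> g -> hf_ob f ==> hf_ob g;
  hmap_id : forall f : hom X Y, hmap (id2 f) = id2 (hf_ob f);
  hmap_vcomp : forall (f g h : hom X Y) (β : g ==> h) (α : f ==> g),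
    hmap (β • α) = hmap β • hmap α
}.

Arguments hmap {E X Y X' Y'} F {f g} α : rename.

(** [ext f] is [f^*]. Structural isomorphisms are written out. *)
Record RelPseudomonad (A E : BicatData) (J : PseudofunctorData A E) : Type := {
  rm_ob :> A -> E;
  ext : forall {X Y : A}, HomFunctor (J X) (rm_ob Y) (rm_ob X) (rm_ob Y);
  ri : forall X : A, hom (J X) (rm_ob X);
  rμ : forall {X Y Z : A} (g : hom (J Y) (rm_ob Z)) (f : hom (J X) (rm_ob Y)),
    ext (ext g · f) ==> ext g · ext f;
  rη : forall {X Y : A} (f : hom (J X) (rm_ob Y)), f ==> ext f · ri X;
  rθ : forall X : A, ext (ri X) ==> id1 (rm_ob X);
  rμ_invertible : forall (X Y Z : A)
    (g : hom (J Y) (rm_ob Z)) (f : hom (J X) (rm_ob Y)), invertible (rμ g f);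
  rη_invertible : forall (X Y : A) (f : hom (J X) (rm_ob Y)), invertible (rη f);
  rθ_invertible : forall X : A, invertible (rθ X);
  rμ_nat_r : forall (X Y Z : A) (g : hom (J Y) (rm_ob Z))
    (f f' : hom (J X) (rm_ob Y)) (α : f ==> f'),
    rμ g f' • hmap ext (ext g ◁ α) = (ext g ◁ hmap ext α) • rμ g f;
  rμ_nat_l : forall (X Y Z : A) (g g' : hom (J Y) (rm_ob Z))
    (f : hom (J X) (rm_ob Y)) (β : g ==> g'),
    rμ g' f • hmap ext (hmap ext β ▷ f) = (hmap ext β ▷ ext f) • rμ g f;
  rη_nat : forall (X Y : A) (f f' : hom (J X) (rm_ob Y)) (α : f ==> f'),
    rη f' • α = (hmap ext α ▷ ri X) • rη f;
  rm_assoc : forall (W X Y Z : A) (f : hom (J W) (rm_ob X))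
    (g : hom (J X) (rm_ob Y)) (h : hom (J Y) (rm_ob Z)),
    assoc (ext h) (ext g) (ext f) • (rμ h g ▷ ext f) • rμ (ext h · g) f
    = (ext h ◁ rμ g f) • rμ h (ext g · f)
      • hmap ext (assoc (ext h) (ext g) f) • hmap ext (rμ h g ▷ f);
  rm_unit : forall (X Y : A) (f : hom (J X) (rm_ob Y)),
    (ext f ◁ rθ X) • rμ f (ri X) • hmap ext (rη f) = runit_inv (ext f)
}.

Arguments ext {A E J} T {X Y} : rename.
Arguments ri {A E J} T X : rename.
Arguments rμ {A E J} T {X Y Z} g f : rename.
Arguments rη {A E J} T {X Y} f : rename.
Arguments rθ {A E J} T X : rename.

Record PsAlgebra (A E : BicatData) (J : PseudofunctorData A E)
    (T : RelPseudomonad J) : Type := {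
  carrier : E;
  aext : forall {X : A}, HomFunctor (J X) carrier (T X) carrier;
  ahat : forall {X Y : A} (g : hom (J Y) carrier) (f : hom (J X) (T Y)),
    aext (aext g · f) ==> aext g · ext T f;
  atilde : forall {X : A} (f : hom (J X) carrier), f ==> aext f · ri T X;
  ahat_invertible : forall (X Y : A)
    (g : hom (J Y) carrier) (f : hom (J X) (T Y)), invertible (ahat g f);
  atilde_invertible : forall (X : A) (f : hom (J X) carrier),
    invertible (atilde f);
  ahat_nat_r : forall (X Y : A) (g : hom (J Y) carrier)
    (f f' : hom (J X) (T Y)) (α : f ==> f'),
    ahat g f' • hmap aext (aext g ◁ α) = (aext g ◁ hmap (ext T) α) • ahat g f;
  ahat_nat_l : forall (X Y : A) (g g' : hom (J Y) carrier)
    (f : hom (J X) (T Y)) (β : g ==> g'),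
    ahat g' f • hmap aext (hmap aext β ▷ f)
    = (hmap aext β ▷ ext T f) • ahat g f;
  atilde_nat : forall (X : A) (f f' : hom (J X) carrier) (α : f ==> f'),
    atilde f' • α = (hmap aext α ▷ ri T X) • atilde f;
  alg_assoc : forall (X Y Z : A) (f : hom (J X) (T Y)) (g : hom (J Y) (T Z))
    (h : hom (J Z) carrier),
    assoc (aext h) (ext T g) (ext T f) • (ahat h g ▷ ext T f)
      • ahat (aext h · g) f
    = (aext h ◁ rμ T g f) • ahat h (ext T g · f)
      • hmap aext (assoc (aext h) (ext T g) f) • hmap aext (ahat h g ▷ f);
  alg_unit : forall (X : A) (f : hom (J X) carrier),
    (aext f ◁ rθ T X) • ahat f (ri T X) • hmap aext (atilde f)
    = runit_inv (aext f)
}.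

Arguments carrier {A E J T} M : rename.
Arguments aext {A E J T} M {X} : rename.
Arguments ahat {A E J T} M {X Y} g f : rename.
Arguments atilde {A E J T} M {X} f : rename.

Definition is_strict_algebra (A E : BicatData) (J : PseudofunctorData A E)
    (T : RelPseudomonad J) (M : PsAlgebra T) : Prop :=
  (forall (X : A) (f : hom (J X) (carrier M)), is_identity (atilde M f)) /\
  (forall (X Y : A) (g : hom (J Y) (carrier M)) (f : hom (J X) (T Y)),
     is_identity (ahat M g f)).

Record LaxData (A E : BicatData) (J : PseudofunctorData A E)
    (T : RelPseudomonad J) (M N : PsAlgebra T) : Type := {
  lmor : hom (carrier M) (carrier N);
  lcell : forall {X : A} (f : hom (J X) (carrier M)),
    aext N (lmor · f) ==> lmor · aext M f
}.

Arguments lmor {A E J T M N} h : rename.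
Arguments lcell {A E J T M N} h {X} f : rename.

Record is_lax_morphism (A E : BicatData) (J : PseudofunctorData A E)
    (T : RelPseudomonad J) (M N : PsAlgebra T) (h : LaxData M N) : Prop := {
  lax_nat : forall (X : A) (f f' : hom (J X) (carrier M)) (α : f ==> f'),
    lcell h f' • hmap (aext N) (lmor h ◁ α)
    = (lmor h ◁ hmap (aext M) α) • lcell h f;
  lax_assoc : forall (X Y : A) (f : hom (J X) (T Y))
    (g : hom (J Y) (carrier M)),
    (lmor h ◁ ahat M g f) • lcell h (aext M g · f)
      • hmap (aext N) (assoc (lmor h) (aext M g) f)
      • hmap (aext N) (lcell h g ▷ f)
    = assoc (lmor h) (aext M g) (ext T f) • (lcell h g ▷ ext T f)
      • ahat N (lmor h · g) f;
  lax_unit : forall (X : A) (f : hom (J X) (carrier M)),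
    assoc (lmor h) (aext M f) (ri T X) • (lcell h f ▷ ri T X)
      • atilde N (lmor h · f)
    = lmor h ◁ atilde M f
}.

Definition is_pseudomorphism (A E : BicatData) (J : PseudofunctorData A E)
    (T : RelPseudomonad J) (M N : PsAlgebra T) (h : LaxData M N) : Prop :=
  forall (X : A) (f : hom (J X) (carrier M)), invertible (lcell h f).

Definition is_strict_morphism (A E : BicatData) (J : PseudofunctorData A E)
    (T : RelPseudomonad J) (M N : PsAlgebra T) (h : LaxData M N) : Prop :=
  forall (X : A) (f : hom (J X) (carrier M)), is_identity (lcell h f).

Definition is_lax_transformation (A E : BicatData) (J : PseudofunctorData A E)
    (T : RelPseudomonad J) (M N : PsAlgebra T) (h h' : LaxData M N)
    (α : lmor h ==> lmor h') : Prop :=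
  forall (X : A) (f : hom (J X) (carrier M)),
    lcell h' f • hmap (aext N) (α ▷ f) = (α ▷ aext M f) • lcell h f.

Definition lax_id (A E : BicatData) (J : PseudofunctorData A E)
    (T : RelPseudomonad J) (M : PsAlgebra T) : LaxData M M := {|
  lmor := id1 (carrier M);
  lcell X f := lunit_inv (aext M f) • hmap (aext M) (lunit f)
|}.

Definition lax_comp (A E : BicatData) (J : PseudofunctorData A E)
    (T : RelPseudomonad J) (L M N : PsAlgebra T)
    (h' : LaxData M N) (h : LaxData L M) : LaxData L N := {|
  lmor := lmor h' · lmor h;
  lcell X f :=
    assoc_inv (lmor h') (lmor h) (aext L f) • (lmor h' ◁ lcell h f)
      • lcell h' (lmor h · f) • hmap (aext N) (assoc (lmor h') (lmor h) f)
|}.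

(** The operations on pseudoalgebras, families [(h, h_f)] subject to no axiom,
    and all 2-cells of [E]. [PsAlg_l] restricts them to lax morphisms and
    transformations. *)
Definition LaxOps (A E : BicatData) (J : PseudofunctorData A E)
    (T : RelPseudomonad J) : BicatData := {|
  ob := PsAlgebra T;
  hom M N := LaxData M N;
  cell M N h h' := lmor h ==> lmor h';
  id1 M := lax_id M;
  comp L M N h' h := lax_comp h' h;
  id2 M N h := id2 (lmor h);
  vcomp M N h h' h'' β α := β • α;
  lwhisk L M N k h h' α := lmor k ◁ α;
  rwhisk L M N k k' β h := β ▷ lmor h;
  assoc K L M N k h g := assoc (lmor k) (lmor h) (lmor g);
  assoc_inv K L M N k h g := assoc_inv (lmor k) (lmor h) (lmor g);
  lunit M N h := lunit (lmor h);
  lunit_inv M N h := lunit_inv (lmor h);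
  runit M N h := runit (lmor h);
  runit_inv M N h := runit_inv (lmor h)
|}.

Definition lax_closed (A E : BicatData) (J : PseudofunctorData A E)
    (T : RelPseudomonad J) : Prop :=
  @cells_closed (LaxOps T) (@is_lax_morphism A E J T)
    (@is_lax_transformation A E J T).

Definition PsAlg_l (A E : BicatData) (J : PseudofunctorData A E)
    (T : RelPseudomonad J) (cl : lax_closed T) : BicatData := cells_sub cl.

Definition pseudo_hom (A E : BicatData) (J : PseudofunctorData A E)
    (T : RelPseudomonad J) (cl : lax_closed T) : HomPred (PsAlg_l cl) :=
  fun M N h => is_pseudomorphism (proj1_sig h).

Definition strict_hom (A E : BicatData) (J : PseudofunctorData A E)
    (T : RelPseudomonad J) (cl : lax_closed T) : HomPred (PsAlg_l cl) :=
  fun M N h => is_strict_morphism (proj1_sig h).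

Definition PsAlg (A E : BicatData) (J : PseudofunctorData A E)
    (T : RelPseudomonad J) (cl : lax_closed T)
    (cp : homs_closed (pseudo_hom (cl := cl))) : BicatData := homs_sub cp.

Definition PsAlg_s (A E : BicatData) (J : PseudofunctorData A E)
    (T : RelPseudomonad J) (cl : lax_closed T)
    (cs : homs_closed (strict_hom (cl := cl))) : BicatData := homs_sub cs.

Record ColaxData (A E : BicatData) (J : PseudofunctorData A E)
    (T : RelPseudomonad J) (M N : PsAlgebra T) : Type := {
  cmor : hom (carrier M) (carrier N);
  ccell : forall {X : A} (f : hom (J X) (carrier M)),
    cmor · aext M f ==> aext N (cmor · f)
}.

Arguments cmor {A E J T M N} h : rename.
Arguments ccell {A E J T M N} h {X} f : rename.

Record is_colax_morphism (A E : BicatData) (J : PseudofunctorData A E)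
    (T : RelPseudomonad J) (M N : PsAlgebra T) (h : ColaxData M N) : Prop := {
  colax_nat : forall (X : A) (f f' : hom (J X) (carrier M)) (α : f ==> f'),
    ccell h f' • (cmor h ◁ hmap (aext M) α)
    = hmap (aext N) (cmor h ◁ α) • ccell h f;
  colax_assoc : forall (X Y : A) (f : hom (J X) (T Y))
    (g : hom (J Y) (carrier M)),
    ahat N (cmor h · g) f • hmap (aext N) (ccell h g ▷ f)
      • hmap (aext N) (assoc_inv (cmor h) (aext M g) f)
      • ccell h (aext M g · f)
    = (ccell h g ▷ ext T f) • assoc_inv (cmor h) (aext M g) (ext T f)
      • (cmor h ◁ ahat M g f);
  colax_unit : forall (X : A) (f : hom (J X) (carrier M)),
    (ccell h f ▷ ri T X) • assoc_inv (cmor h) (aext M f) (ri T X)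
      • (cmor h ◁ atilde M f)
    = atilde N (cmor h · f)
}.

Definition is_colax_transformation (A E : BicatData) (J : PseudofunctorData A E)
    (T : RelPseudomonad J) (M N : PsAlgebra T) (h h' : ColaxData M N)
    (α : cmor h ==> cmor h') : Prop :=
  forall (X : A) (f : hom (J X) (carrier M)),
    hmap (aext N) (α ▷ f) • ccell h f = ccell h' f • (α ▷ aext M f).

Definition colax_id (A E : BicatData) (J : PseudofunctorData A E)
    (T : RelPseudomonad J) (M : PsAlgebra T) : ColaxData M M := {|
  cmor := id1 (carrier M);
  ccell X f := hmap (aext M) (lunit_inv f) • lunit (aext M f)
|}.

Definition colax_comp (A E : BicatData) (J : PseudofunctorData A E)
    (T : RelPseudomonad J) (L M N : PsAlgebra T)
    (h' : ColaxData M N) (h : ColaxData L M) : ColaxData L N := {|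
  cmor := cmor h' · cmor h;
  ccell X f :=
    hmap (aext N) (assoc_inv (cmor h') (cmor h) f) • ccell h' (cmor h · f)
      • (cmor h' ◁ ccell h f) • assoc (cmor h') (cmor h) (aext L f)
|}.

Definition ColaxOps (A E : BicatData) (J : PseudofunctorData A E)
    (T : RelPseudomonad J) : BicatData := {|
  ob := PsAlgebra T;
  hom M N := ColaxData M N;
  cell M N h h' := cmor h ==> cmor h';
  id1 M := colax_id M;
  comp L M N h' h := colax_comp h' h;
  id2 M N h := id2 (cmor h);
  vcomp M N h h' h'' β α := β • α;
  lwhisk L M N k h h' α := cmor k ◁ α;
  rwhisk L M N k k' β h := β ▷ cmor h;
  assoc K L M N k h g := assoc (cmor k) (cmor h) (cmor g);
  assoc_inv K L M N k h g := assoc_inv (cmor k) (cmor h) (cmor g);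
  lunit M N h := lunit (cmor h);
  lunit_inv M N h := lunit_inv (cmor h);
  runit M N h := runit (cmor h);
  runit_inv M N h := runit_inv (cmor h)
|}.

Definition colax_closed (A E : BicatData) (J : PseudofunctorData A E)
    (T : RelPseudomonad J) : Prop :=
  @cells_closed (ColaxOps T) (@is_colax_morphism A E J T)
    (@is_colax_transformation A E J T).

Definition PsAlg_c (A E : BicatData) (J : PseudofunctorData A E)
    (T : RelPseudomonad J) (cc : colax_closed T) : BicatData := cells_sub cc.

Definition invert_pseudo (A E : BicatData) (J : PseudofunctorData A E)
    (T : RelPseudomonad J) (M N : PsAlgebra T) (h : LaxData M N)
    (Hh : is_pseudomorphism h) : ColaxData M N := {|
  cmor := lmor h;
  ccell X f := inv2 (Hh X f)
|}.

Definition colax_of (A E : BicatData) (J : PseudofunctorData A E)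
    (T : RelPseudomonad J) (cl : lax_closed T)
    (cp : homs_closed (pseudo_hom (cl := cl))) (M N : PsAlg cp)
    (h : hom M N) : ColaxData M N := invert_pseudo (proj2_sig h).

(** What has to hold for [h |-> colax_of h], with the identity on objects and on
    2-cells and with identity constraints, to take values in [PsAlg_c]. *)
Record colax_of_valid (A E : BicatData) (J : PseudofunctorData A E)
    (T : RelPseudomonad J) (cl : lax_closed T)
    (cp : homs_closed (pseudo_hom (cl := cl))) : Prop := {
  cv_hom : forall (M N : PsAlg cp) (h : hom M N), is_colax_morphism (colax_of h);
  cv_cell : forall (M N : PsAlg cp) (h h' : hom M N) (α : h ==> h'),
    is_colax_transformation (h := colax_of h) (h' := colax_of h') (proj1_sig α);
  cv_comp : forall (L M N : PsAlg cp) (k : hom M N) (h : hom L M),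
    is_colax_transformation
      (h := colax_comp (colax_of k) (colax_of h)) (h' := colax_of (k · h))
      (id2 (cmor (colax_of k) · cmor (colax_of h)));
  cv_id : forall M : PsAlg cp,
    is_colax_transformation (h := colax_id M) (h' := colax_of (id1 M))
      (id2 (id1 (carrier M)))
}.

Definition PsAlg_to_PsAlg_c (A E : BicatData) (J : PseudofunctorData A E)
    (T : RelPseudomonad J) (cl : lax_closed T)
    (cp : homs_closed (pseudo_hom (cl := cl))) (cc : colax_closed T)
    (v : colax_of_valid cp) : PseudofunctorData (PsAlg cp) (PsAlg_c cc) :=
  @Build_PseudofunctorData (PsAlg cp) (PsAlg_c cc)
    (fun M => M)
    (fun M N h => exist _ (colax_of h) (cv_hom v h))
    (fun M N h h' α => exist _ (proj1_sig α) (cv_cell v α))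
    (fun L M N k h =>
       exist _ (id2 (cmor (colax_of k) · cmor (colax_of h))) (cv_comp v k h))
    (fun M => exist _ (id2 (id1 (carrier M))) (cv_id v (M := M))).

Definition Alg_l (A E : BicatData) (J : PseudofunctorData A E)
    (T : RelPseudomonad J) (cl : lax_closed T) : BicatData :=
  full_sub (B := PsAlg_l cl) (@is_strict_algebra A E J T).

Definition Alg (A E : BicatData) (J : PseudofunctorData A E)
    (T : RelPseudomonad J) (cl : lax_closed T)
    (cp : homs_closed (pseudo_hom (cl := cl))) : BicatData :=
  full_sub (B := PsAlg cp) (@is_strict_algebra A E J T).

Definition Alg_s (A E : BicatData) (J : PseudofunctorData A E)
    (T : RelPseudomonad J) (cl : lax_closed T)
    (cs : homs_closed (strict_hom (cl := cl))) : BicatData :=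
  full_sub (B := PsAlg_s cs) (@is_strict_algebra A E J T).

Definition Alg_c (A E : BicatData) (J : PseudofunctorData A E)
    (T : RelPseudomonad J) (cc : colax_closed T) : BicatData :=
  full_sub (B := PsAlg_c cc) (@is_strict_algebra A E J T).

(* Main.v *)
Require Import Defs.
From Corelib Require Import ssreflect.
From Stdlib Require Import ClassicalEpsilon FunctionalExtensionality.
From Stdlib Require Import ProofIrrelevance.

Set Implicit Arguments.
Unset Strict Implicit.
Unset Printing Implicit Defensive.

Local Open Scope bicat_scope.

(** Everything happens at the level of 2-cells. Forgetting structure,
    pseudoalgebras with families [(h, h_f)] subject to no axiom and all 2-cells
    of [E] between the underlying 1-cells already form a bicategory, because a
    bicategory law is an equation between 2-cells of [E]. The laws of all the
    bicategories in question are inherited from it, and what has to be proved is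
    closure: lax morphisms contain the identities and compose, and the
    whiskerings and structural 2-cells of [E] are transformations
    ([lax_morphisms_closed]). Closure under composition pastes the axioms of the
    two factors with the pentagon and the naturality of associators; the
    identities need in addition Kelly's law relating [lunit] and [assoc]
    ([lunit_assoc]).

    The colax case is the lax case in the bicategory [co E] with reversed
    2-cells. There the inverses of [μ], [η], [θ], [â], [ã] make [T] into a
    relative pseudomonad and each pseudoalgebra into a pseudoalgebra
    ([co_monad], [co_algebra]), and a colax morphism is a lax morphism between
    the reversed pseudoalgebras ([co_lax_morphism]): in the lax axioms [â] and
    [ã] occur inverted, and conjugating the square by them gives the colax
    axioms.

    For pseudomorphisms, invertible 2-cells are closed under the formulas that
    define identities and composites. Inverting the structure 2-cells conjugates
    lax axioms into colax axioms, for 1-cells ([invert_pseudo_colax]) and for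
    2-cells ([invert_pseudo_transformation]); the latter holds in both
    directions, so the comparison with colax morphisms is locally fully
    faithful. It is strict because inverses are unique, so that composing and
    inverting commute.

    When [E] is a 2-category, a transformation whose 2-cell is an identity has
    equal source and target ([lax_transformation_is_identity]). Hence the
    associators and unitors of [PsAlg_l] are identities, and restricting 1-cells
    or objects preserves this; strict morphisms are closed under composition
    because every factor of the composite structure 2-cell is an identity. *)

(** * Calculus of 2-cells *)

Section TwoCells.
Variables (B : BicatData) (HB : is_bicategory B).

(** Lets an equation [β • α = γ] rewrite inside a right-associated composite. *)
Lemma vcomp_tail (X Y : B) (f g h : hom X Y)
    (β : g ==> h) (α : f ==> g) (γ : f ==> h) :
  β • α = γ -> forall (e : hom X Y) (δ : e ==> f), β • (α • δ) = γ • δ.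
Proof. by move=> <- e δ; rewrite (vcomp_assoc HB). Qed.

Lemma vcomp_tail3 (X Y : B) (f g h k : hom X Y)
    (γ : h ==> k) (β : g ==> h) (α : f ==> g) (δ : f ==> k) :
  γ • (β • α) = δ ->
  forall (e : hom X Y) (ε : e ==> f), γ • (β • (α • ε)) = δ • ε.
Proof. by move=> <- e ε; rewrite -!(vcomp_assoc HB). Qed.

Lemma vcomp_tail4 (X Y : B) (f g h k l : hom X Y)
    (δ : k ==> l) (γ : h ==> k) (β : g ==> h) (α : f ==> g) (ε : f ==> l) :
  δ • (γ • (β • α)) = ε ->
  forall (e : hom X Y) (ζ : e ==> f), δ • (γ • (β • (α • ζ))) = ε • ζ.
Proof. by move=> <- e ζ; rewrite -!(vcomp_assoc HB). Qed.

Definition is_inverse (X Y : B) (f g : hom X Y) (α : f ==> g) (β : g ==> f) :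
    Prop :=
  β • α = id2 f /\ α • β = id2 g.

Lemma is_inverse_sym (X Y : B) (f g : hom X Y) (α : f ==> g) (β : g ==> f) :
  is_inverse α β -> is_inverse β α.
Proof. by case. Qed.

Lemma is_inverse_invertible (X Y : B) (f g : hom X Y)
    (α : f ==> g) (β : g ==> f) : is_inverse α β -> invertible α.
Proof. by exists β. Qed.

Lemma inv2_inverse (X Y : B) (f g : hom X Y) (α : f ==> g)
    (Hα : invertible α) : is_inverse α (inv2 Hα).
Proof.
exact: (proj2_sig (constructive_indefinite_description _ Hα)).
Qed.

Lemma is_inverse_unique (X Y : B) (f g : hom X Y) (α : f ==> g)
    (β β' : g ==> f) : is_inverse α β -> is_inverse α β' -> β = β'.
Proof.
move=> [βα _] [_ αβ'].
by rewrite -(vcomp_id_r HB β) -αβ' (vcomp_assoc HB) βα (vcomp_id_l HB).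
Qed.

(** A square whose parallel sides [α] and [β] are invertible stays commutative
    when these sides are reversed. This exchanges the axioms for lax and for
    colax structure. *)
Lemma inverse_square (X Y : B) (f g f' g' : hom X Y)
    (α : f ==> g) (α' : g ==> f) (β : f' ==> g') (β' : g' ==> f')
    (ξ : g ==> g') (υ : f ==> f') :
  β • υ = ξ • α -> is_inverse α α' -> is_inverse β β' -> υ • α' = β' • ξ.
Proof.
move=> sq [_ αα'] [β'β _].
rewrite -(vcomp_id_l HB υ) -β'β -(vcomp_assoc HB β') sq.
by rewrite -!(vcomp_assoc HB) αα' (vcomp_id_r HB).
Qed.

Lemma inverse_eq (X Y : B) (f g : hom X Y) (α α' : f ==> g) (β β' : g ==> f) :
  α = α' -> is_inverse α β -> is_inverse α' β' -> β = β'.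
Proof. by move=> ->; exact: is_inverse_unique. Qed.

Lemma is_inverse_id2 (X Y : B) (f : hom X Y) : is_inverse (id2 f) (id2 f).
Proof. by split; rewrite (vcomp_id_l HB). Qed.

Lemma is_inverse_vcomp (X Y : B) (f g h : hom X Y)
    (β : g ==> h) (β' : h ==> g) (α : f ==> g) (α' : g ==> f) :
  is_inverse β β' -> is_inverse α α' -> is_inverse (β • α) (α' • β').
Proof.
move=> [l r] [l' r']; split; rewrite -(vcomp_assoc HB).
- by rewrite (vcomp_tail l) (vcomp_id_l HB).
- by rewrite (vcomp_tail r') (vcomp_id_l HB).
Qed.

Lemma is_inverse_lwhisk (X Y Z : B) (g : hom Y Z) (f f' : hom X Y)
    (α : f ==> f') (α' : f' ==> f) :
  is_inverse α α' -> is_inverse (g ◁ α) (g ◁ α').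
Proof.
by move=> [l r]; split; rewrite -(lwhisk_vcomp HB) ?l ?r (lwhisk_id HB).
Qed.

Lemma is_inverse_rwhisk (X Y Z : B) (g g' : hom Y Z) (f : hom X Y)
    (β : g ==> g') (β' : g' ==> g) :
  is_inverse β β' -> is_inverse (β ▷ f) (β' ▷ f).
Proof.
by move=> [l r]; split; rewrite -(rwhisk_vcomp HB) ?l ?r (rwhisk_id HB).
Qed.

Lemma is_inverse_hmap (X Y X' Y' : B) (F : HomFunctor X Y X' Y')
    (f f' : hom X Y) (α : f ==> f') (α' : f' ==> f) :
  is_inverse α α' -> is_inverse (hmap F α) (hmap F α').
Proof. by move=> [l r]; split; rewrite -hmap_vcomp ?l ?r hmap_id. Qed.

Lemma is_inverse_assoc (W X Y Z : B) (h : hom Y Z) (g : hom X Y) (f : hom W X) :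
  is_inverse (assoc h g f) (assoc_inv h g f).
Proof. by split; [exact: (assocK HB) | exact: (assocVK HB)]. Qed.

Lemma is_inverse_lunit (X Y : B) (f : hom X Y) :
  is_inverse (lunit f) (lunit_inv f).
Proof. by split; [exact: (lunitK HB) | exact: (lunitVK HB)]. Qed.

Lemma is_inverse_runit (X Y : B) (f : hom X Y) :
  is_inverse (runit f) (runit_inv f).
Proof. by split; [exact: (runitK HB) | exact: (runitVK HB)]. Qed.

Lemma assoc_inv_nat_r (W X Y Z : B) (h : hom Y Z) (g : hom X Y)
    (f f' : hom W X) (α : f ==> f') :
  assoc_inv h g f' • (h ◁ (g ◁ α)) = ((h · g) ◁ α) • assoc_inv h g f.
Proof.
symmetry; apply: inverse_square; try exact: is_inverse_assoc.
by rewrite (assoc_nat_r HB).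
Qed.

Lemma assoc_inv_nat_m (W X Y Z : B) (h : hom Y Z) (g g' : hom X Y)
    (f : hom W X) (β : g ==> g') :
  assoc_inv h g' f • (h ◁ (β ▷ f)) = ((h ◁ β) ▷ f) • assoc_inv h g f.
Proof.
symmetry; apply: inverse_square; try exact: is_inverse_assoc.
by rewrite (assoc_nat_m HB).
Qed.

Lemma assoc_inv_nat_l (W X Y Z : B) (h h' : hom Y Z) (g : hom X Y)
    (f : hom W X) (γ : h ==> h') :
  assoc_inv h' g f • (γ ▷ (g · f)) = ((γ ▷ g) ▷ f) • assoc_inv h g f.
Proof.
symmetry; apply: inverse_square; try exact: is_inverse_assoc.
by rewrite (assoc_nat_l HB).
Qed.

Lemma lunit_inv_nat (X Y : B) (f f' : hom X Y) (α : f ==> f') :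
  lunit_inv f' • α = (id1 Y ◁ α) • lunit_inv f.
Proof.
symmetry; apply: inverse_square; try exact: is_inverse_lunit.
by rewrite (lunit_nat HB).
Qed.

Lemma runit_inv_nat (X Y : B) (f f' : hom X Y) (α : f ==> f') :
  runit_inv f' • α = (α ▷ id1 X) • runit_inv f.
Proof.
symmetry; apply: inverse_square; try exact: is_inverse_runit.
by rewrite (runit_nat HB).
Qed.

Lemma lwhisk_id1_inj (X Y : B) (f f' : hom X Y) (α β : f ==> f') :
  id1 Y ◁ α = id1 Y ◁ β -> α = β.
Proof.
move=> eq1.
rewrite -(vcomp_id_r HB α) -(vcomp_id_r HB β) -(lunitVK HB) !(vcomp_assoc HB).
by rewrite -!(lunit_nat HB) eq1.
Qed.

Lemma vcomp_cancel_r (X Y : B) (f g h : hom X Y) (α : f ==> g) (α' : g ==> f)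
    (β γ : g ==> h) : is_inverse α α' -> β • α = γ • α -> β = γ.
Proof.
move=> [_ r] e.
by rewrite -(vcomp_id_r HB β) -(vcomp_id_r HB γ) -r !(vcomp_assoc HB) e.
Qed.

(** Kelly's coherence law: after whiskering by [id1 Z], which is faithful, it
    follows from one pentagon and two triangles. *)
Lemma lunit_assoc (X Y Z : B) (g : hom Y Z) (f : hom X Y) :
  lunit (g · f) • assoc (id1 Z) g f = lunit g ▷ f.
Proof.
apply: lwhisk_id1_inj.
apply: (vcomp_cancel_r (α := assoc (id1 Z) (id1 Z · g) f
                               • (assoc (id1 Z) (id1 Z) g ▷ f))).
  apply: is_inverse_vcomp; first exact: is_inverse_assoc.
  by apply: is_inverse_rwhisk; exact: is_inverse_assoc.
rewrite (lwhisk_vcomp HB) -!(vcomp_assoc HB) (vcomp_assoc HB (_ ◁ assoc _ _ _)).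
rewrite (pentagon HB) (vcomp_assoc HB) (triangle HB) -(assoc_nat_l HB).
rewrite (vcomp_assoc HB) -(assoc_nat_m HB) -(vcomp_assoc HB).
by rewrite -(rwhisk_vcomp HB) (triangle HB).
Qed.

Lemma lunit_inv_assoc (X Y Z : B) (g : hom Y Z) (f : hom X Y) :
  assoc (id1 Z) g f • (lunit_inv g ▷ f) = lunit_inv (g · f).
Proof.
rewrite -(vcomp_id_l HB (_ • _)) -(lunitK HB) -(vcomp_assoc HB).
rewrite (vcomp_assoc HB (lunit _)) lunit_assoc -(rwhisk_vcomp HB) (lunitVK HB).
by rewrite (rwhisk_id HB) (vcomp_id_r HB).
Qed.

(** In composites of lax morphisms the pentagon occurs with one factor inverted,
    because [lax_comp] contains [assoc_inv], whiskered in the axioms. *)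
Lemma pentagon_inv (V W X Y Z : B)
    (k : hom Y Z) (h : hom X Y) (g : hom W X) (f : hom V W) :
  assoc (k · h) g f • (assoc_inv k h g ▷ f)
  = assoc_inv k h (g · f) • ((k ◁ assoc h g f) • assoc k (h · g) f).
Proof.
apply: inverse_square.
- exact: (eq_sym (pentagon HB _ _ _ _)).
- by apply: is_inverse_rwhisk; exact: is_inverse_assoc.
- exact: is_inverse_assoc.
Qed.

Lemma lunit_assoc_inv (X Y Z : B) (g : hom Y Z) (f : hom X Y) :
  (lunit g ▷ f) • assoc_inv (id1 Z) g f = lunit (g · f).
Proof.
by rewrite -lunit_assoc -(vcomp_assoc HB) (assocVK HB) (vcomp_id_r HB).
Qed.

Lemma triangle_inv (X Y Z : B) (g : hom Y Z) (f : hom X Y) :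
  (runit g ▷ f) • assoc_inv g (id1 Y) f = g ◁ lunit f.
Proof.
by rewrite -(triangle HB) -(vcomp_assoc HB) (assocVK HB) (vcomp_id_r HB).
Qed.

Lemma pentagon_inv_inv (V W X Y Z : B)
    (k : hom Y Z) (h : hom X Y) (g : hom W X) (f : hom V W) :
  (assoc k h g ▷ f) • (assoc_inv (k · h) g f • assoc_inv k h (g · f))
  = assoc_inv k (h · g) f • (k ◁ assoc_inv h g f).
Proof.
rewrite -[RHS](vcomp_id_r HB).
apply: (inverse_square (eq_trans (pentagon HB k h g f)
                          (eq_sym (vcomp_id_l HB _)))).
- by apply: is_inverse_vcomp; exact: is_inverse_assoc.
- apply: is_inverse_vcomp; last exact: is_inverse_assoc.
  by apply: is_inverse_lwhisk; exact: is_inverse_assoc.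
Qed.

Lemma is_identity_invertible (X Y : B) (f g : hom X Y) (α : f ==> g) :
  is_identity α -> invertible α.
Proof. by case; exact: is_inverse_invertible (is_inverse_id2 f). Qed.

Lemma is_identity_inverse (X Y : B) (f g : hom X Y) (α : f ==> g)
    (β : g ==> f) : is_inverse α β -> is_identity α -> is_identity β.
Proof.
move=> inv idα; case: g α / idα β inv => β [βα _].
by rewrite -(vcomp_id_r HB β) βα; exact: is_identity_id2.
Qed.

Lemma is_identity_vcomp (X Y : B) (f g h : hom X Y)
    (β : g ==> h) (α : f ==> g) :
  is_identity β -> is_identity α -> is_identity (β • α).
Proof. by case=> {h β}; rewrite (vcomp_id_l HB). Qed.

Lemma is_identity_lwhisk (X Y Z : B) (g : hom Y Z) (f f' : hom X Y)
    (α : f ==> f') : is_identity α -> is_identity (g ◁ α).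
Proof. by case; rewrite (lwhisk_id HB); exact: is_identity_id2. Qed.

Lemma is_identity_hmap (X Y X' Y' : B) (F : HomFunctor X Y X' Y')
    (f f' : hom X Y) (α : f ==> f') : is_identity α -> is_identity (hmap F α).
Proof. by case; rewrite hmap_id; exact: is_identity_id2. Qed.

End TwoCells.

(** Proves [is_inverse α β] when [β] is the composite of the inverses of the
    factors of [α], bracketed the opposite way. *)
Ltac inverses :=
  repeat first
    [ exact: is_inverse_assoc | exact: is_inverse_lunit
    | exact: is_inverse_runit | exact: inv2_inverse
    | apply: is_inverse_vcomp | apply: is_inverse_lwhisk
    | apply: is_inverse_rwhisk | apply: is_inverse_hmap
    | apply: is_inverse_sym; first
        [ exact: is_inverse_assoc | exact: is_inverse_lunit
        | exact: is_inverse_runit ] ].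

(** * Sub-bicategories *)

Lemma sig_eq (T : Type) (P : T -> Prop) (u v : {x | P x}) :
  proj1_sig u = proj1_sig v -> u = v.
Proof. by apply: eq_sig_hprop => x p q; exact: proof_irrelevance. Qed.

Section SubBicategories.
Variable B : BicatData.

Lemma cells_sub_bicategory (P : HomPred B) (Q : CellPred B)
    (c : cells_closed P Q) : is_bicategory B -> is_bicategory (cells_sub c).
Proof. by case=> *; split=> * /=; apply: sig_eq => /=; auto. Qed.

Lemma homs_sub_bicategory (P : HomPred B) (c : homs_closed P) :
  is_bicategory B -> is_bicategory (homs_sub c).
Proof. by case=> *; split=> * /=; auto. Qed.

Lemma full_sub_bicategory (P : B -> Prop) :
  is_bicategory B -> is_bicategory (full_sub P).
Proof. by case=> *; split=> * /=; auto. Qed.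

Lemma cells_sub_is_identity (P : HomPred B) (Q : CellPred B)
    (c : cells_closed P Q) (X Y : cells_sub c) (f g : hom X Y) (α : f ==> g) :
  is_identity (proj1_sig α) -> is_identity α.
Proof.
case: f g α => [f Pf] [g Pg] /= [α Qα] /= idα; simpl in α, Qα.
case: g α / idα Pg Qα => Pg Qα.
rewrite (proof_irrelevance _ Pg Pf) in Qα *.
rewrite (proof_irrelevance _ Qα (cc_id2 c Pf)).
exact: (@is_identity_id2 (cells_sub c) X Y (exist _ f Pf)).
Qed.

Lemma homs_sub_is_identity (P : HomPred B) (c : homs_closed P)
    (X Y : homs_sub c) (f g : hom X Y) (α : proj1_sig f ==> proj1_sig g) :
  is_identity α -> @is_identity (homs_sub c) X Y f g α.
Proof.
case: f g α => [f Pf] [g Pg] /= α idα.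
case: g α / idα Pg => Pg.
rewrite (proof_irrelevance _ Pg Pf).
exact: (@is_identity_id2 (homs_sub c) X Y (exist _ f Pf)).
Qed.

Lemma homs_sub_2category (P : HomPred B) (c : homs_closed P) :
  is_2category B -> is_2category (homs_sub c).
Proof.
case=> HB Ba Bl Br; split; first exact: homs_sub_bicategory.
- by move=> W X Y Z h g f; apply: homs_sub_is_identity; exact: Ba.
- by move=> X Y f; apply: homs_sub_is_identity; exact: Bl.
- by move=> X Y f; apply: homs_sub_is_identity; exact: Br.
Qed.

Lemma full_sub_is_identity (P : B -> Prop) (X Y : full_sub P) (f g : hom X Y)
    (α : f ==> g) : @is_identity B _ _ f g α -> is_identity α.
Proof. by case; exact: (@is_identity_id2 (full_sub P) X Y f). Qed.

Lemma full_sub_2category (P : B -> Prop) :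
  is_2category B -> is_2category (full_sub P).
Proof.
case=> HB Ba Bl Br; split; first exact: full_sub_bicategory.
- by move=> W X Y Z h g f; apply: full_sub_is_identity; exact: Ba.
- by move=> X Y f; apply: full_sub_is_identity; exact: Bl.
- by move=> X Y f; apply: full_sub_is_identity; exact: Br.
Qed.

End SubBicategories.

Section Inclusions.
Variables (B : BicatData) (HB : is_bicategory B).

Ltac solve_strict :=
  rewrite /= ?(lwhisk_id HB) ?(rwhisk_id HB) ?(vcomp_id_l HB) ?(vcomp_id_r HB).

Lemma homs_incl_strict (P : HomPred B) (c : homs_closed P) :
  is_strict_pseudofunctor (homs_incl c).
Proof.
split; [split|..] => *; solve_strict => //.
all: try exact: is_identity_id2.
all: exact: is_inverse_invertible (is_inverse_id2 HB _).
Qed.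

Lemma homs_incl_fully_faithful (P : HomPred B) (c : homs_closed P) :
  locally_fully_faithful (homs_incl c).
Proof. by move=> X Y f g β; exists β; split=> // α. Qed.

Lemma homs_sub_map_strict (P P' : HomPred B)
    (c : homs_closed P) (c' : homs_closed P')
    (PP' : forall (X Y : B) (f : hom X Y), P X Y f -> P' X Y f) :
  is_strict_pseudofunctor (homs_sub_map c c' PP').
Proof.
split; [split|..] => *; solve_strict => //.
all: try by apply: homs_sub_is_identity; exact: is_identity_id2.
all: apply: is_inverse_invertible.
all: exact: (is_inverse_id2 (homs_sub_bicategory c' HB) _).
Qed.

Lemma homs_sub_map_fully_faithful (P P' : HomPred B)
    (c : homs_closed P) (c' : homs_closed P')
    (PP' : forall (X Y : B) (f : hom X Y), P X Y f -> P' X Y f) :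
  locally_fully_faithful (homs_sub_map c c' PP').
Proof. by move=> X Y f g β; exists β; split=> // α. Qed.

Lemma full_incl_full_inclusion (P : B -> Prop) :
  is_full_inclusion (full_incl P).
Proof.
split.
- split; [split|..] => *; solve_strict => //.
  all: try exact: is_identity_id2.
  all: exact: is_inverse_invertible (is_inverse_id2 HB _).
- exact: sig_eq.
- by move=> X Y k; exists k; split=> // f.
- by move=> X Y f g β; exists β; split=> // α.
Qed.

End Inclusions.

(** * Lax morphisms *)

Section Lax.
Variables (A : BicatData) (E : Bicategory) (J : PseudofunctorData A E).
Variable T : RelPseudomonad J.
Let HE : is_bicategory E := bicat_laws E.

Implicit Types K L M N : PsAlgebra T.

(** The laws only concern 2-cells, which are those of [E]. *)
Lemma lax_ops_bicategory : is_bicategory (LaxOps T).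
Proof. by case: HE => *; split=> * /=; auto. Qed.

Lemma lax_id_lax M : is_lax_morphism (lax_id M).
Proof.
split=> /=.
- move=> X f f' α; rewrite -!(vcomp_assoc HE) -hmap_vcomp (lunit_nat HE).
  by rewrite hmap_vcomp (vcomp_tail HE (lunit_inv_nat HE _)) -(vcomp_assoc HE).
- move=> X Y f g; rewrite !(rwhisk_vcomp HE) !hmap_vcomp -!(vcomp_assoc HE).
  rewrite (vcomp_tail HE (eq_sym (lunit_inv_nat HE _))) -!(vcomp_assoc HE).
  rewrite -!hmap_vcomp (vcomp_tail HE (lunit_assoc HE _ _)).
  rewrite (vcomp_assoc HE (_ ▷ _)) -(rwhisk_vcomp HE) (lunitVK HE).
  by rewrite (rwhisk_id HE) (vcomp_id_l HE) ahat_nat_l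
    (vcomp_tail HE (lunit_inv_assoc HE _ _)).
- move=> X f; rewrite (rwhisk_vcomp HE) -!(vcomp_assoc HE) -atilde_nat.
  rewrite (vcomp_tail HE (lunit_inv_assoc HE _ _)) (vcomp_assoc HE).
  by rewrite (lunit_inv_nat HE) -(vcomp_assoc HE) (lunitK HE) (vcomp_id_r HE).
Qed.

(** Each axiom for the composite follows by pasting the same axiom for [h],
    whiskered by [k], with the one for [k]. The associators brought in by
    [lax_comp] are moved out of the way by naturality and cancel by
    [pentagon_inv]. *)
Lemma lax_comp_lax L M N (k : LaxData M N) (h : LaxData L M) :
  is_lax_morphism k -> is_lax_morphism h -> is_lax_morphism (lax_comp k h).
Proof.
move=> Hk Hh; split=> /=.
- move=> X f f' α; rewrite -!(vcomp_assoc HE) -hmap_vcomp (assoc_nat_r HE).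
  rewrite hmap_vcomp (vcomp_tail HE (lax_nat Hk _)) -!(vcomp_assoc HE).
  rewrite (vcomp_tail HE (eq_sym (lwhisk_vcomp HE _ _ _))) (lax_nat Hh).
  rewrite (lwhisk_vcomp HE) -!(vcomp_assoc HE).
  by rewrite (vcomp_tail HE (assoc_inv_nat_r HE _ _ _)) -!(vcomp_assoc HE).
- move=> X Y f g.
  rewrite !(rwhisk_vcomp HE) !hmap_vcomp -!(vcomp_assoc HE).
  (* With all factors under one [hmap], the pentagon moves the associators
     aside and makes the structure 2-cell of [h] appear whiskered by [k], where
     [lax_nat] applies. *)
  rewrite -!hmap_vcomp.
  rewrite (vcomp_tail HE (pentagon_inv HE _ _ _ _)) -!(vcomp_assoc HE).
  rewrite (vcomp_tail HE (assocVK HE _ _ _)) (vcomp_id_l HE).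
  rewrite (vcomp_tail HE (assoc_nat_m HE _ _ _)) !hmap_vcomp -!(vcomp_assoc HE).
  rewrite (vcomp_tail HE (lax_nat Hk _)) -!(vcomp_assoc HE).
  rewrite (vcomp_tail HE (lax_nat Hk _)) -!(vcomp_assoc HE).
  rewrite (vcomp_tail HE (eq_sym (assoc_inv_nat_r HE _ _ _))) -!(vcomp_assoc HE).
  rewrite !(vcomp_tail HE (eq_sym (lwhisk_vcomp HE _ _ _))) -!(vcomp_assoc HE).
  (* What remains is the left-hand side of the axiom of [h], whiskered by [k],
     after which that of the axiom of [k] appears. *)
  have eh := lax_assoc Hh f g; rewrite -!(vcomp_assoc HE) in eh.
  have ek := lax_assoc Hk f (lmor h · g); rewrite -!(vcomp_assoc HE) in ek.
  rewrite eh !(lwhisk_vcomp HE) -!(vcomp_assoc HE) (vcomp_tail4 HE ek).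
  rewrite -!(vcomp_assoc HE) ahat_nat_l.
  rewrite (vcomp_tail HE (eq_sym (assoc_nat_m HE _ _ _))) -!(vcomp_assoc HE).
  by rewrite (vcomp_tail HE (pentagon_inv HE _ _ _ _)) -!(vcomp_assoc HE).
- move=> X f; rewrite !(rwhisk_vcomp HE) -!(vcomp_assoc HE).
  rewrite -atilde_nat.
  have eh := lax_unit Hh f; have ek := lax_unit Hk (lmor h · f).
  rewrite -!(vcomp_assoc HE) in eh ek.
  rewrite (vcomp_tail HE (pentagon_inv HE _ _ _ _)) -!(vcomp_assoc HE).
  rewrite (vcomp_tail HE (assoc_nat_m HE _ _ _)) -!(vcomp_assoc HE).
  rewrite (vcomp_tail3 HE ek) !(vcomp_tail HE (eq_sym (lwhisk_vcomp HE _ _ _))).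
  rewrite -!(vcomp_assoc HE) eh (vcomp_tail HE (assoc_inv_nat_r HE _ _ _)).
  by rewrite -(vcomp_assoc HE) (assocK HE) (vcomp_id_r HE).
Qed.

Lemma lax_transformation_id2 M N (h : LaxData M N) :
  is_lax_transformation (h := h) (h' := h) (id2 (lmor h)).
Proof.
move=> X f.
by rewrite !(rwhisk_id HE) hmap_id (vcomp_id_l HE) (vcomp_id_r HE).
Qed.

Lemma lax_transformation_vcomp M N (h h' h'' : LaxData M N)
    (β : lmor h' ==> lmor h'') (α : lmor h ==> lmor h') :
  is_lax_transformation β -> is_lax_transformation α ->
  is_lax_transformation (β • α).
Proof.
move=> Hβ Hα X f.
rewrite !(rwhisk_vcomp HE) hmap_vcomp (vcomp_assoc HE) Hβ -!(vcomp_assoc HE).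
by rewrite Hα.
Qed.

(** Halves the work for the structural 2-cells: the transformation axiom passes
    to their inverses. *)
Lemma lax_transformation_inverse M N (h h' : LaxData M N)
    (α : lmor h ==> lmor h') (β : lmor h' ==> lmor h) :
  is_lax_transformation α -> is_inverse α β -> is_lax_transformation β.
Proof.
move=> Hα inv X f; apply: (inverse_square HE (eq_sym (Hα X f))).
- by apply: is_inverse_hmap; apply: (is_inverse_rwhisk HE); exact: inv.
- by apply: (is_inverse_rwhisk HE); exact: inv.
Qed.

Lemma lax_transformation_lwhisk L M N (k : LaxData M N) (h h' : LaxData L M)
    (α : lmor h ==> lmor h') :
  is_lax_morphism k -> is_lax_transformation α ->
  is_lax_transformation (h := lax_comp k h) (h' := lax_comp k h')
    (lmor k ◁ α).
Proof.
move=> Hk Hα X f /=; rewrite -!(vcomp_assoc HE) -hmap_vcomp (assoc_nat_m HE).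
rewrite hmap_vcomp (vcomp_tail HE (lax_nat Hk _)) -!(vcomp_assoc HE).
rewrite (vcomp_tail HE (eq_sym (lwhisk_vcomp HE _ _ _))) Hα.
rewrite (lwhisk_vcomp HE) -!(vcomp_assoc HE).
by rewrite (vcomp_tail HE (assoc_inv_nat_m HE _ _ _)) -!(vcomp_assoc HE).
Qed.

Lemma lax_transformation_rwhisk L M N (k k' : LaxData M N) (h : LaxData L M)
    (β : lmor k ==> lmor k') :
  is_lax_transformation β ->
  is_lax_transformation (h := lax_comp k h) (h' := lax_comp k' h)
    (β ▷ lmor h).
Proof.
move=> Hβ X f /=; rewrite -!(vcomp_assoc HE) -hmap_vcomp (assoc_nat_l HE).
rewrite hmap_vcomp (vcomp_tail HE (Hβ _ _)) -!(vcomp_assoc HE).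
rewrite (vcomp_tail HE (eq_sym (interchange HE _ _))) -!(vcomp_assoc HE).
by rewrite (vcomp_tail HE (assoc_inv_nat_l HE _ _ _)) -!(vcomp_assoc HE).
Qed.

Lemma lax_transformation_lunit M N (h : LaxData M N) :
  is_lax_transformation (h := lax_comp (lax_id N) h) (h' := h) (lunit (lmor h)).
Proof.
move=> X f /=; rewrite -!(vcomp_assoc HE) -hmap_vcomp (lunit_assoc HE).
rewrite (vcomp_tail HE (lunit_assoc_inv HE _ _)).
rewrite (vcomp_tail HE (lunit_nat HE _)) -(vcomp_assoc HE).
by rewrite (vcomp_tail HE (lunitVK HE _)) (vcomp_id_l HE).
Qed.

Lemma lax_transformation_runit M N (h : LaxData M N) : is_lax_morphism h ->
  is_lax_transformation (h := lax_comp h (lax_id M)) (h' := h) (runit (lmor h)).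
Proof.
move=> Hh X f /=.
rewrite (lwhisk_vcomp HE) -!(vcomp_assoc HE).
rewrite (vcomp_tail HE (eq_sym (lax_nat Hh _))) -!(vcomp_assoc HE).
rewrite (vcomp_tail HE (triangle_inv HE _ _)) (vcomp_assoc HE (_ ◁ _)).
rewrite -(lwhisk_vcomp HE) (lunitVK HE) (lwhisk_id HE) (vcomp_id_l HE).
by rewrite -hmap_vcomp (triangle HE).
Qed.

Lemma lax_transformation_assoc K L M N
    (k : LaxData M N) (h : LaxData L M) (g : LaxData K L) :
  is_lax_morphism k ->
  is_lax_transformation (h := lax_comp (lax_comp k h) g)
    (h' := lax_comp k (lax_comp h g)) (assoc (lmor k) (lmor h) (lmor g)).
Proof.
move=> Hk X f /=; rewrite !(lwhisk_vcomp HE) -!(vcomp_assoc HE).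
rewrite (vcomp_tail HE (eq_sym (lax_nat Hk _))).
rewrite -!(vcomp_assoc HE) -!hmap_vcomp.
rewrite (vcomp_assoc HE _ (assoc _ _ _)) (pentagon HE).
rewrite (vcomp_tail HE (eq_sym (assoc_inv_nat_r HE _ _ _))) -!(vcomp_assoc HE).
by rewrite (vcomp_tail3 HE (pentagon_inv_inv HE _ _ _ _)) -!(vcomp_assoc HE).
Qed.

Lemma lax_morphisms_closed : lax_closed T.
Proof.
split.
- exact: lax_id_lax.
- move=> L M N k h; exact: lax_comp_lax.
- move=> M N h _; exact: lax_transformation_id2.
- move=> M N h h' h'' β α _ _ _; exact: lax_transformation_vcomp.
- move=> L M N k h h' α Hk _ _; exact: lax_transformation_lwhisk.
- move=> L M N k k' β h _ _ _; exact: lax_transformation_rwhisk.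
- move=> K L M N k h g Hk _ _; exact: lax_transformation_assoc.
- move=> K L M N k h g Hk _ _.
  exact: (lax_transformation_inverse (lax_transformation_assoc h g Hk)
            (is_inverse_assoc HE _ _ _)).
- move=> M N h _; exact: lax_transformation_lunit.
- move=> M N h _.
  exact: (lax_transformation_inverse (lax_transformation_lunit h)
            (is_inverse_lunit HE _)).
- move=> M N h Hh; exact: lax_transformation_runit.
- move=> M N h Hh.
  exact: (lax_transformation_inverse (lax_transformation_runit Hh)
            (is_inverse_runit HE _)).
Qed.

(** For an identity 2-cell, the transformation axiom says that the two families
    of structure 2-cells coincide. *)
Lemma lax_transformation_is_identity M N (h h' : LaxData M N)
    (α : lmor h ==> lmor h') :
  is_lax_transformation α -> is_identity α ->
  @is_identity (LaxOps T) M N h h' α.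
Proof.
case: h h' α => [h hc] [h' hc'] /= α Hα idα; simpl in α.
case: h' α / idα hc' Hα => hc' Hα.
have <- : hc = hc'; last first.
  exact: (@is_identity_id2 (LaxOps T) M N (Build_LaxData hc)).
apply: functional_extensionality_dep => X.
apply: functional_extensionality_dep => f.
have /= := Hα X f.
by rewrite !(rwhisk_id HE) hmap_id (vcomp_id_l HE) (vcomp_id_r HE).
Qed.

End Lax.

(** * Reversal of 2-cells *)

Definition co_data (B : BicatData) : BicatData := {|
  ob := B;
  hom X Y := hom X Y;
  cell X Y f g := g ==> f;
  id1 X := id1 X;
  comp X Y Z g f := g · f;
  id2 X Y f := id2 f;
  vcomp X Y f g h β α := α • β;
  lwhisk X Y Z g f f' α := g ◁ α;
  rwhisk X Y Z g g' β f := β ▷ f;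
  assoc W X Y Z h g f := assoc_inv h g f;
  assoc_inv W X Y Z h g f := assoc h g f;
  lunit X Y f := lunit_inv f;
  lunit_inv X Y f := lunit f;
  runit X Y f := runit_inv f;
  runit_inv X Y f := runit f
|}.

Lemma co_bicategory (B : BicatData) :
  is_bicategory B -> is_bicategory (co_data B).
Proof.
move=> HB; split=> /=.
- by move=> *; rewrite (vcomp_assoc HB).
- by move=> *; exact: (vcomp_id_r HB).
- by move=> *; exact: (vcomp_id_l HB).
- by move=> *; exact: (lwhisk_id HB).
- by move=> *; exact: (lwhisk_vcomp HB).
- by move=> *; exact: (rwhisk_id HB).
- by move=> *; exact: (rwhisk_vcomp HB).
- by move=> *; rewrite (interchange HB).
- by move=> *; rewrite (assoc_inv_nat_r HB).
- by move=> *; rewrite (assoc_inv_nat_m HB).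
- by move=> *; rewrite (assoc_inv_nat_l HB).
- by move=> *; rewrite (lunit_inv_nat HB).
- by move=> *; rewrite (runit_inv_nat HB).
- by move=> *; exact: (assocK HB).
- by move=> *; exact: (assocVK HB).
- by move=> *; exact: (lunitK HB).
- by move=> *; exact: (lunitVK HB).
- by move=> *; exact: (runitK HB).
- by move=> *; exact: (runitVK HB).
- move=> V W X Y Z k h g f.
  apply: (is_inverse_unique HB (α := assoc k h (g · f) • assoc (k · h) g f)).
    rewrite -(pentagon HB); apply: (is_inverse_vcomp HB).
      apply: (is_inverse_vcomp HB); last exact: (is_inverse_assoc HB).
      by apply: (is_inverse_lwhisk HB); exact: (is_inverse_assoc HB).
    by apply: (is_inverse_rwhisk HB); exact: (is_inverse_assoc HB).
  by apply: (is_inverse_vcomp HB); exact: (is_inverse_assoc HB).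
- move=> X Y Z g f; apply: (is_inverse_unique HB (α := runit g ▷ f)).
    rewrite -(triangle HB); apply: (is_inverse_vcomp HB).
      by apply: (is_inverse_lwhisk HB); exact: (is_inverse_lunit HB).
    exact: (is_inverse_assoc HB).
  by apply: (is_inverse_rwhisk HB); exact: (is_inverse_runit HB).
Qed.

Definition co (B : Bicategory) : Bicategory :=
  Build_Bicategory (co_bicategory (bicat_laws B)).

Definition co_pf (A B : BicatData) (F : Pseudofunctor A B) :
    PseudofunctorData (co_data A) (co_data B) :=
  @Build_PseudofunctorData (co_data A) (co_data B) (fun X => F X)
    (fun X Y f => pf_hom F f)
    (fun X Y f g α => pf_cell F α)
    (fun X Y Z g f => inv2 (compositor_invertible (pf_laws F) g f))
    (fun X => inv2 (unitor_invertible (pf_laws F) X)).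

Definition co_hom_functor (B : BicatData) (X Y X' Y' : B)
    (F : HomFunctor X Y X' Y') :
    @HomFunctor (co_data B) X Y X' Y' :=
  @Build_HomFunctor (co_data B) X Y X' Y' F (fun f g α => hmap F α)
    (hmap_id F) (fun f g h β α => hmap_vcomp F α β).

Section Reversal.
Variables (A : BicatData) (E : Bicategory) (J : Pseudofunctor A E).
Variable T : RelPseudomonad J.
Let HE : is_bicategory E := bicat_laws E.

Lemma co_invertible (X Y : E) (f g : hom X Y) (α : f ==> g)
    (Hα : invertible α) : @invertible (co_data E) X Y f g (inv2 Hα).
Proof. by exists α; have [] := inv2_inverse Hα. Qed.

(** Each law is the law of [T] with the invertible sides of its square reversed,
    or says that equal 2-cells have equal inverses. *)
Definition co_monad : RelPseudomonad (co_pf J).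
Proof.
refine (@Build_RelPseudomonad (co_data A) (co E) (co_pf J) (fun X => T X)
  (fun X Y => co_hom_functor (ext T)) (fun X => ri T X)
  (fun X Y Z g f => inv2 (rμ_invertible g f))
  (fun X Y f => inv2 (rη_invertible f))
  (fun X => inv2 (rθ_invertible T X)) _ _ _ _ _ _ _ _).
- by move=> *; exact: co_invertible.
- by move=> *; exact: co_invertible.
- by move=> *; exact: co_invertible.
- move=> X Y Z g f f' α /=.
  by apply: (inverse_square HE (rμ_nat_r g α)); inverses.
- move=> X Y Z g g' f β /=.
  by apply: (inverse_square HE (rμ_nat_l f β)); inverses.
- move=> X Y f f' α /=.
  by apply: (inverse_square HE (rη_nat α)); inverses.
- move=> W X Y Z f g h /=.
  by apply: (inverse_eq HE (rm_assoc f g h)); inverses.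
- move=> X Y f /=.
  by apply: (inverse_eq HE (rm_unit f)); inverses.
Defined.

Definition co_algebra (M : PsAlgebra T) : PsAlgebra co_monad.
Proof.
refine (@Build_PsAlgebra (co_data A) (co E) (co_pf J) co_monad (carrier M)
  (fun X => co_hom_functor (aext M))
  (fun X Y g f => inv2 (ahat_invertible g f))
  (fun X f => inv2 (atilde_invertible f)) _ _ _ _ _ _ _).
- by move=> *; exact: co_invertible.
- by move=> *; exact: co_invertible.
- move=> X Y g f f' α /=.
  by apply: (inverse_square HE (ahat_nat_r (T := T) g α)); inverses.
- move=> X Y g g' f β /=.
  by apply: (inverse_square HE (ahat_nat_l (T := T) f β)); inverses.
- move=> X f f' α /=.
  by apply: (inverse_square HE (atilde_nat α)); inverses.
- move=> X Y Z f g h /=.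
  by apply: (inverse_eq HE (alg_assoc (T := T) f g h)); inverses.
- move=> X f /=.
  by apply: (inverse_eq HE (alg_unit f)); inverses.
Defined.

End Reversal.

(** * Colax morphisms *)

Section Colax.
Variables (A : BicatData) (E : Bicategory) (J : Pseudofunctor A E).
Variable T : RelPseudomonad J.
Let HE : is_bicategory E := bicat_laws E.

Implicit Types K L M N : PsAlgebra T.

(** The data agree on the nose: a structure 2-cell of a colax morphism is one of
    a lax morphism in [co E]. *)
Definition co_lax M N (h : ColaxData M N) :
    LaxData (co_algebra M) (co_algebra N) :=
  @Build_LaxData _ (co E) _ (co_monad T) (co_algebra M) (co_algebra N)
    (cmor h) (fun X f => ccell h f).

Lemma co_lax_comp L M N (k : ColaxData M N) (h : ColaxData L M) :
  co_lax (colax_comp k h) = lax_comp (co_lax k) (co_lax h).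
Proof.
congr Build_LaxData.
apply: functional_extensionality_dep => X.
apply: functional_extensionality_dep => f.
by rewrite /= -!(vcomp_assoc HE).
Qed.

(** Naturality is literally the same equation. The other two axioms differ by
    [ahat] and [atilde], which [co_algebra] replaces by their inverses. *)
Lemma co_lax_morphism M N (h : ColaxData M N) :
  is_lax_morphism (co_lax h) <-> is_colax_morphism h.
Proof.
split=> [[nat_h assoc_h unit_h]|[nat_h assoc_h unit_h]]; split=> /=.
- move=> X f f' α; exact: (eq_sym (nat_h X f' f α)).
- move=> X Y f g; have /= sq := assoc_h X Y f g.
  rewrite (vcomp_assoc HE (hmap _ _)) (vcomp_assoc HE (hmap _ _ • _)) in sq.
  apply: eq_sym; rewrite -2!(vcomp_assoc HE (ahat _ _ _)).
  by apply: (inverse_square HE (eq_sym sq)); apply: is_inverse_sym; inverses.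
- move=> X f; have /= sq := unit_h X f.
  rewrite -(vcomp_id_r HE (atilde N _)).
  rewrite -[RHS](vcomp_id_l HE) in sq.
  by apply: (inverse_square HE sq); apply: is_inverse_sym; inverses.
- move=> X f f' α; exact: (eq_sym (nat_h X f' f α)).
- move=> X Y f g.
  rewrite (vcomp_assoc HE (hmap _ _)) (vcomp_assoc HE (hmap _ _ • _)).
  have sq := assoc_h X Y f g; rewrite -2!(vcomp_assoc HE (ahat _ _ _)) in sq.
  by apply: (inverse_square HE sq); inverses.
- move=> X f; have sq := unit_h X f; rewrite -[RHS](vcomp_id_r HE) in sq.
  rewrite -[RHS](vcomp_id_l HE); apply: eq_sym.
  by apply: (inverse_square HE (eq_sym sq)); inverses.
Qed.

Lemma colax_ops_bicategory : is_bicategory (ColaxOps T).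
Proof. by case: HE => *; split=> * /=; auto. Qed.

(** [is_colax_transformation α] from [h] to [h'] unfolds to
    [is_lax_transformation α] from [co_lax h'] to [co_lax h]; for composite
    1-cells the two axioms then differ by bracketing only. *)
Lemma colax_morphisms_closed : colax_closed T.
Proof.
case: (lax_morphisms_closed (E := co E) (co_monad T)).
move=> id1c compc id2c vcompc lwhiskc rwhiskc.
move=> assocc assoc_invc lunitc lunit_invc runitc runit_invc.
have lax_of M N (h : ColaxData M N) := proj2 (co_lax_morphism h).
split.
- by move=> M; apply/co_lax_morphism; exact: id1c.
- move=> L M N k h /lax_of Hk /lax_of Hh; apply/co_lax_morphism.
  by rewrite co_lax_comp; exact: compc.
- by move=> M N h /lax_of Hh X f; exact: (id2c _ _ _ Hh X f).
- move=> M N h h' h'' β α /lax_of Hh /lax_of Hh' /lax_of Hh'' Hβ Hα X f.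
  exact: (vcompc _ _ (co_lax h'') (co_lax h') (co_lax h) α β
            Hh'' Hh' Hh Hα Hβ X f).
- move=> L M N k h h' α /lax_of Hk /lax_of Hh /lax_of Hh' Hα X f.
  have /= := lwhiskc _ _ _ (co_lax k) (co_lax h') (co_lax h) α Hk Hh' Hh Hα X f.
  by rewrite -!(vcomp_assoc HE) => ->.
- move=> L M N k k' β h /lax_of Hk /lax_of Hk' /lax_of Hh Hβ X f.
  have /= := rwhiskc _ _ _ (co_lax k') (co_lax k) β _ Hk' Hk Hh Hβ X f.
  by rewrite -!(vcomp_assoc HE) => ->.
- move=> K L M N k h g /lax_of Hk /lax_of Hh /lax_of Hg X f.
  have /= := assoc_invc _ _ _ _ _ _ _ Hk Hh Hg X f.
  by rewrite !(lwhisk_vcomp HE) -!(vcomp_assoc HE) => ->.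
- move=> K L M N k h g /lax_of Hk /lax_of Hh /lax_of Hg X f.
  have /= := assocc _ _ _ _ _ _ _ Hk Hh Hg X f.
  by rewrite !(lwhisk_vcomp HE) -!(vcomp_assoc HE) => ->.
- move=> M N h /lax_of Hh X f; have /= := lunit_invc _ _ _ Hh X f.
  by rewrite -!(vcomp_assoc HE) => ->.
- move=> M N h /lax_of Hh X f; have /= := lunitc _ _ _ Hh X f.
  by rewrite -!(vcomp_assoc HE) => ->.
- move=> M N h /lax_of Hh X f; have /= := runit_invc _ _ _ Hh X f.
  by rewrite !(lwhisk_vcomp HE) -!(vcomp_assoc HE) => ->.
- move=> M N h /lax_of Hh X f; have /= := runitc _ _ _ Hh X f.
  by rewrite !(lwhisk_vcomp HE) -!(vcomp_assoc HE) => ->.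
Qed.

Lemma colax_transformation_is_identity M N (h h' : ColaxData M N)
    (α : cmor h ==> cmor h') :
  is_colax_transformation α -> is_identity α ->
  @is_identity (ColaxOps T) M N h h' α.
Proof.
case: h h' α => [h hc] [h' hc'] /= α Hα idα; simpl in α.
case: h' α / idα hc' Hα => hc' Hα.
have -> : hc' = hc; last first.
  exact: (@is_identity_id2 (ColaxOps T) M N (Build_ColaxData hc)).
apply: functional_extensionality_dep => X.
apply: functional_extensionality_dep => f.
have /= := Hα X f.
by rewrite !(rwhisk_id HE) hmap_id (vcomp_id_l HE) (vcomp_id_r HE).
Qed.

Lemma PsAlg_c_bicategory (cc : colax_closed T) : is_bicategory (PsAlg_c cc).
Proof. by apply: cells_sub_bicategory; exact: colax_ops_bicategory. Qed.

End Colax.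

(** * Pseudomorphisms *)

Section Pseudo.
Variables (A : BicatData) (E : Bicategory) (J : PseudofunctorData A E).
Variable T : RelPseudomonad J.
Let HE : is_bicategory E := bicat_laws E.

Implicit Types L M N : PsAlgebra T.

Lemma invert_id_cell M (X : A) (f : hom (J X) (carrier M)) :
  is_inverse (lcell (lax_id M) f) (ccell (colax_id M) f).
Proof. by rewrite /=; inverses. Qed.

(** The composite of colax morphisms is given by the factors of [lax_comp],
    inverted and in reverse order. *)
Lemma invert_comp_cell L M N (k : LaxData M N) (h : LaxData L M)
    (Hk : is_pseudomorphism k) (Hh : is_pseudomorphism h)
    (X : A) (f : hom (J X) (carrier L)) :
  is_inverse (lcell (lax_comp k h) f)
    (ccell (colax_comp (invert_pseudo Hk) (invert_pseudo Hh)) f).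
Proof.
rewrite /= -2!(vcomp_assoc HE (hmap _ (assoc_inv _ _ _))).
by rewrite -(vcomp_assoc HE (inv2 _)); inverses.
Qed.

Lemma invert_pseudo_colax M N (h : LaxData M N) (Hh : is_pseudomorphism h) :
  is_lax_morphism h -> is_colax_morphism (invert_pseudo Hh).
Proof.
move=> lax_h; split=> /=.
- move=> X f f' α.
  by apply: eq_sym; apply: (inverse_square HE (lax_nat lax_h α)); inverses.
- move=> X Y f g; rewrite -2!(vcomp_assoc HE (ahat _ _ _)).
  rewrite -(vcomp_assoc HE (hmap _ _)).
  have sq := lax_assoc lax_h f g; rewrite -2!(vcomp_assoc HE (_ ◁ _)) in sq.
  by apply: (inverse_square HE (eq_sym sq)); inverses.
- move=> X f; rewrite -(lax_unit lax_h) -!(vcomp_assoc HE).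
  rewrite (vcomp_tail HE (assocK HE _ _ _)) (vcomp_id_l HE) (vcomp_assoc HE).
  have [inv_h _] := inv2_inverse (Hh X f).
  by rewrite -(rwhisk_vcomp HE) inv_h (rwhisk_id HE) (vcomp_id_l HE).
Qed.

Lemma invert_pseudo_transformation M N (h h' : LaxData M N)
    (Hh : is_pseudomorphism h) (Hh' : is_pseudomorphism h')
    (α : lmor h ==> lmor h') :
  is_colax_transformation (h := invert_pseudo Hh) (h' := invert_pseudo Hh') α
  <-> is_lax_transformation α.
Proof.
split=> Hα X f.
- apply: eq_sym; apply: (inverse_square HE (eq_sym (Hα X f))).
    by apply: is_inverse_sym; exact: inv2_inverse.
  by apply: is_inverse_sym; exact: inv2_inverse.
- by apply: (inverse_square HE (Hα X f)); exact: inv2_inverse.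
Qed.

Lemma invert_pseudo_comp L M N (k : LaxData M N) (h : LaxData L M)
    (Hk : is_pseudomorphism k) (Hh : is_pseudomorphism h)
    (Hkh : is_pseudomorphism (lax_comp k h)) :
  is_colax_transformation
    (h := colax_comp (invert_pseudo Hk) (invert_pseudo Hh))
    (h' := invert_pseudo Hkh) (id2 (lmor k · lmor h)).
Proof.
move=> X f.
rewrite !(rwhisk_id HE) hmap_id (vcomp_id_l HE) (vcomp_id_r HE).
exact: (is_inverse_unique HE (invert_comp_cell Hk Hh f) (inv2_inverse _)).
Qed.

Lemma invert_pseudo_id M (H1 : is_pseudomorphism (lax_id M)) :
  is_colax_transformation (h := colax_id M) (h' := invert_pseudo H1)
    (id2 (id1 (carrier M))).
Proof.
move=> X f.
rewrite !(rwhisk_id HE) hmap_id (vcomp_id_l HE) (vcomp_id_r HE).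
exact: (is_inverse_unique HE (invert_id_cell f) (inv2_inverse _)).
Qed.

Variable cl : lax_closed T.

Lemma pseudo_closed : homs_closed (pseudo_hom (cl := cl)).
Proof.
split.
- move=> M X f; exact: is_inverse_invertible (invert_id_cell f).
- move=> L M N k h Hk Hh X f.
  exact: is_inverse_invertible (invert_comp_cell Hk Hh f).
Qed.

Lemma colax_of_is_valid (cp : homs_closed (pseudo_hom (cl := cl))) :
  colax_of_valid cp.
Proof.
split.
- move=> M N [[h lax_h] Hh]; exact: invert_pseudo_colax.
- move=> M N h h' α; apply/invert_pseudo_transformation; exact: (proj2_sig α).
- move=> L M N k h; destruct k as [[k lax_k] Hk], h as [[h lax_h] Hh].
  cbv [colax_of].
  cbn [proj1_sig proj2_sig comp PsAlg PsAlg_l homs_sub cells_sub LaxOps].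
  exact (invert_pseudo_comp Hk Hh _).
- move=> M; exact: invert_pseudo_id.
Qed.

End Pseudo.

Section PseudoToColax.
Variables (A : BicatData) (E : Bicategory) (J : Pseudofunctor A E).
Variables (T : RelPseudomonad J) (cl : lax_closed T).
Variables (cp : homs_closed (pseudo_hom (cl := cl))) (cc : colax_closed T).
Variable cv : colax_of_valid cp.
Let HE : is_bicategory E := bicat_laws E.

Lemma PsAlg_to_PsAlg_c_fully_faithful :
  locally_fully_faithful (PsAlg_to_PsAlg_c cc cv).
Proof.
move=> M N f g [β Hβ].
exists (exist _ β (proj1 (invert_pseudo_transformation _ _ _) Hβ)); split.
  exact: sig_eq.
move=> [α Hα] e; apply: sig_eq => /=.
by have /= := f_equal (@proj1_sig _ _) e.
Qed.

(** Source and target agree since [invert_comp_cell] and [inv2] both give an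
    inverse of the structure 2-cell of [k · h], which is what [cv_comp] says. *)
Lemma compositor_is_identity (L M N : PsAlg cp) (k : hom M N) (h : hom L M) :
  is_identity (compositor (PsAlg_to_PsAlg_c cc cv) k h).
Proof.
apply: cells_sub_is_identity.
exact: (colax_transformation_is_identity (cv_comp cv k h)
          (is_identity_id2 _)).
Qed.

Lemma unitor_is_identity (M : PsAlg cp) :
  is_identity (unitor (PsAlg_to_PsAlg_c cc cv) M).
Proof.
apply: cells_sub_is_identity.
exact: (colax_transformation_is_identity (cv_id cv (M := M))
          (is_identity_id2 _)).
Qed.

(** Unfolding the restrictions exposes equations between 2-cells of [E] in which
    the compositors and unitors are [id2]. *)
Ltac to_base_cells :=
  cbn [proj1_sig proj2_sig PsAlg_to_PsAlg_c pf_ob pf_cell pf_hom compositor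
       unitor id1 comp id2 vcomp lwhisk rwhisk assoc lunit runit
       cells_sub homs_sub PsAlg PsAlg_l PsAlg_c ColaxOps LaxOps
       cmor lmor colax_comp lax_comp colax_id lax_id colax_of invert_pseudo].

Lemma PsAlg_to_PsAlg_c_strict : is_strict_pseudofunctor (PsAlg_to_PsAlg_c cc cv).
Proof.
split; [split|..].
- by move=> M N h; apply: sig_eq.
- move=> M N h h' h'' β α; apply: sig_eq; to_base_cells.
  reflexivity.
- move=> L M N k h; apply: (is_identity_invertible (PsAlg_c_bicategory cc)).
  exact: compositor_is_identity.
- move=> M; apply: (is_identity_invertible (PsAlg_c_bicategory cc)).
  exact: unitor_is_identity.
- move=> L M N k h h' α; apply: sig_eq; to_base_cells.
  by rewrite (vcomp_id_l HE) (vcomp_id_r HE).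
- move=> L M N k k' h β; apply: sig_eq; to_base_cells.
  by rewrite (vcomp_id_l HE) (vcomp_id_r HE).
- move=> K L M N k h g; apply: sig_eq; to_base_cells.
  rewrite (rwhisk_id HE) (lwhisk_id HE) !(vcomp_id_r HE).
  by rewrite (vcomp_id_l HE).
- move=> M N h; apply: sig_eq; to_base_cells.
  by rewrite (rwhisk_id HE) !(vcomp_id_r HE).
- move=> M N h; apply: sig_eq; to_base_cells.
  by rewrite (lwhisk_id HE) !(vcomp_id_r HE).
- exact: compositor_is_identity.
- exact: unitor_is_identity.
Qed.

End PseudoToColax.

(** * Strict morphisms *)

(** The associators and unitors of [E] are identities and transformations at the
    same time. *)
Lemma PsAlg_l_2category (A : BicatData) (E : Bicategory)
    (J : PseudofunctorData A E) (T : RelPseudomonad J) (cl : lax_closed T) :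
  is_2category E -> is_2category (PsAlg_l cl).
Proof.
case=> HE Ea El Er; split.
- by apply: cells_sub_bicategory; exact: lax_ops_bicategory.
- move=> K L M N k h g; apply: cells_sub_is_identity => /=.
  apply: lax_transformation_is_identity; last exact: Ea.
  exact: (lax_transformation_assoc _ _ (proj2_sig k)).
- move=> M N h; apply: cells_sub_is_identity => /=.
  apply: lax_transformation_is_identity; last exact: El.
  exact: lax_transformation_lunit.
- move=> M N h; apply: cells_sub_is_identity => /=.
  apply: lax_transformation_is_identity; last exact: Er.
  exact: (lax_transformation_runit (proj2_sig h)).
Qed.

Lemma strict_closed (A : BicatData) (E : Bicategory)
    (J : PseudofunctorData A E) (T : RelPseudomonad J) (cl : lax_closed T) :
  is_2category E -> homs_closed (strict_hom (cl := cl)).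
Proof.
case=> HE Ea El _; split.
- move=> M X f; apply: (is_identity_vcomp HE).
    exact: (is_identity_inverse HE (is_inverse_lunit HE _) (El _ _ _)).
  by apply: is_identity_hmap; exact: El.
- move=> L M N k h Hk Hh X f; apply: (is_identity_vcomp HE).
    apply: (is_identity_vcomp HE); last exact: Hk.
    apply: (is_identity_vcomp HE).
      apply: (is_identity_inverse HE (is_inverse_assoc HE _ _ _)).
      exact: Ea.
    by apply: (is_identity_lwhisk HE); exact: Hh.
  by apply: is_identity_hmap; exact: Ea.
Qed.

Theorem proposition3p10 (A E : Bicategory) (J : Pseudofunctor A E)
    (T : RelPseudomonad J) :
  exists (cl : lax_closed T)
         (cp : homs_closed (pseudo_hom (cl := cl)))
         (cc : colax_closed T)
         (cv : colax_of_valid cp),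
    is_bicategory (PsAlg_l cl) /\
    (is_bicategory (PsAlg cp) /\
     is_strict_pseudofunctor (homs_incl cp : PseudofunctorData (PsAlg cp) (PsAlg_l cl)) /\
     locally_fully_faithful (homs_incl cp : PseudofunctorData (PsAlg cp) (PsAlg_l cl))) /\
    (is_bicategory (PsAlg_c cc) /\
     is_strict_pseudofunctor (PsAlg_to_PsAlg_c cc cv) /\
     locally_fully_faithful (PsAlg_to_PsAlg_c cc cv)) /\
    (is_bicategory (Alg_l cl) /\
     is_full_inclusion (full_incl _ : PseudofunctorData (Alg_l cl) (PsAlg_l cl))) /\
    (is_bicategory (Alg cp) /\
     is_full_inclusion (full_incl _ : PseudofunctorData (Alg cp) (PsAlg cp))) /\
    (is_bicategory (Alg_c cc) /\
     is_full_inclusion (full_incl _ : PseudofunctorData (Alg_c cc) (PsAlg_c cc))) /\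
    (is_2category E ->
     exists (cs : homs_closed (strict_hom (cl := cl)))
            (sp : forall (M N : PsAlg_l cl) (h : hom M N),
                    strict_hom h -> pseudo_hom h),
       is_2category (PsAlg_s cs) /\
       is_strict_2functor
         (homs_sub_map cs cp sp : PseudofunctorData (PsAlg_s cs) (PsAlg cp)) /\
       locally_fully_faithful
         (homs_sub_map cs cp sp : PseudofunctorData (PsAlg_s cs) (PsAlg cp)) /\
       is_2category (Alg_s cs) /\
       is_full_inclusion
         (full_incl _ : PseudofunctorData (Alg_s cs) (PsAlg_s cs))).
Proof.
pose cl := lax_morphisms_closed T.
have cp : homs_closed (pseudo_hom (cl := cl)) := pseudo_closed cl.
have cc := colax_morphisms_closed T.
have cv : colax_of_valid cp := colax_of_is_valid cp.
have bicat_l := cells_sub_bicategory cl (lax_ops_bicategory T).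
have bicat_p := homs_sub_bicategory cp bicat_l.
have bicat_c := PsAlg_c_bicategory cc.
exists cl, cp, cc, cv; split; first exact: bicat_l.
split.
  by split=> //; split;
    [exact: homs_incl_strict | exact: homs_incl_fully_faithful].
split.
  by split=> //; split;
    [exact: PsAlg_to_PsAlg_c_strict | exact: PsAlg_to_PsAlg_c_fully_faithful].
split.
  by split; [exact: full_sub_bicategory | exact: full_incl_full_inclusion].
split.
  by split; [exact: full_sub_bicategory | exact: full_incl_full_inclusion].
split.
  by split; [exact: full_sub_bicategory | exact: full_incl_full_inclusion].
move=> E2.
have l2 : is_2category (PsAlg_l cl) by exact: PsAlg_l_2category.
have cs := strict_closed cl E2.
have sp (M N : PsAlg_l cl) (h : hom M N) : strict_hom h -> pseudo_hom h.
  move=> Hh X f; exact: (is_identity_invertible (bicat_laws E) (Hh X f)).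
have s2 := homs_sub_2category cs l2.
exists cs, sp; split; first exact: s2.
split.
  split; first exact: s2.
  by split; [exact: homs_sub_2category | exact: homs_sub_map_strict].
split; first exact: homs_sub_map_fully_faithful.
split; first exact: full_sub_2category.
by apply: full_incl_full_inclusion; exact: is_2category_bicategory s2.
Qed.
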